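(* Let $((F,\nu,N),[\,,]_{F,h},(\rho,\eta))$ be a generalized Lie algebroid and $d^F$ its exterior differentiation operator. Then: 1. For any $\omega\in\Lambda^q(F,\nu,N)$ and $\theta\in\Lambda^r(F,\nu,N)$, $d^F(\omega\wedge\theta)=d^F\omega\wedge\theta+(-1)^q\omega\wedge d^F\theta$. 2. For any $z\in\Gamma(F,\nu,N)$, $L_z\circ d^F=d^F\circ L_z$. 3. $d^F\circ d^F=0$.
   Context: Manifolds are smooth and finite-dimensional, vector bundles are real of finite rank; $\mathcal F(N)=C^\infty(N,\mathbb R)$, and $\Gamma(F,\nu,N)$ is the $\mathcal F(N)$-module of smooth sections of $\nu:F\to N$. For a vector bundle morphism $(\varphi,\varphi_0)$ with $\varphi_0$ a diffeomorphism, $\Gamma(\varphi,\varphi_0)u=\varphi\circ u\circ\varphi_0^{-1}$ on sections. A generalized Lie algebroid $((F,\nu,N),[\,,]_{F,h},(\rho,\eta))$ consists of manifolds $M,N$, diffeomorphisms $h:M\to N$ and $\eta:N\to M$, a vector bundle $(F,\nu,N)$, a vector bundle morphism $\rho:F\to TM$ covering $\eta$, and a bracket $[\,,]_{F,h}$ on $\Gamma(F,\nu,N)$ such that: (1) $[u,fv]_{F,h}=f[u,v]_{F,h}+\big(\Gamma(Th\circ\rho,h\circ\eta)(u)f\big)v$ for all sections $u,v$ and $f\in\mathcal F(N)$; (2) the bracket is $\mathbb R$-bilinear, antisymmetric and satisfies the Jacobi identity; (3) $\Gamma(Th\circ\rho,h\circ\eta):\Gamma(F,\nu,N)\to\Gamma(TN,\tau_N,N)$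 is a Lie algebra morphism into vector fields on $N$. $\Lambda^q(F,\nu,N)$ is the set of alternating $\mathcal F(N)$-$q$-linear maps $\Gamma(F,\nu,N)^q\to\mathcal F(N)$, with $\Lambda^0(F,\nu,N)=\mathcal F(N)$. The exterior product is $(\omega\wedge\theta)(z_1,\dots,z_{q+r})=\frac1{q!r!}\sum_{\sigma\in\Sigma_{q+r}}\mathrm{sgn}(\sigma)\,\omega(z_{\sigma(1)},\dots,z_{\sigma(q)})\,\theta(z_{\sigma(q+1)},\dots,z_{\sigma(q+r)})$. For $z\in\Gamma(F,\nu,N)$, the covariant Lie derivative is $L_zf=\Gamma(Th\circ\rho,h\circ\eta)z(f)$ for $f\in\mathcal F(N)$ and $L_z\omega(z_1,\dots,z_q)=\Gamma(Th\circ\rho,h\circ\eta)z\big(\omega(z_1,\dots,z_q)\big)-\sum_{i=1}^q\omega(z_1,\dots,[z,z_i]_{F,h},\dots,z_q)$ for $\omega\in\Lambda^q(F,\nu,N)$. The exterior differentiation operator $d^F:\Lambda^q(F,\nu,N)\to\Lambda^{q+1}(F,\nu,N)$ is $$d^F\omega(z_0,\dots,z_q)=\sum_{i=0}^q(-1)^i\,\Gamma(Th\circ\rho,h\circ\eta)z_i\big(\omega(z_0,\dots,\hat z_i,\dots,z_q)\big)+\sum_{i<j}(-1)^{i+j}\omega([z_i,z_j]_{F,h},z_0,\dots,\hat z_i,\dots,\hat z_j,\dots,z_q).$$ *)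

(* Defs.v *)
From HB Require Import structures.
From mathcomp Require Import all_boot all_order all_algebra all_fingroup.
From mathcomp Require Import all_classical all_reals.
From mathcomp Require Import topology normedtype derive.

Set Implicit Arguments.
Unset Strict Implicit.
Unset Printing Implicit Defensive.

Import Order.TTheory GRing.Theory Num.Theory.
Import numFieldNormedType.Exports.

Local Open Scope classical_set_scope.
Local Open Scope ring_scope.

(** * Smooth maps between finite-dimensional normed spaces *)

(* [U] is meant to be open.  In finite dimension the Frechet derivative
   x |-> 'd f x is of class C^k iff all its evaluations x |-> 'd f x v are. *)
Fixpoint Ck (R : realType) (V W : normedModType R) (k : nat) (U : set V)
    (f : V -> W) : Prop :=
  if k is k'.+1 then
    (forall x, U x -> differentiable f x) /\
    (forall v, Ck k' U (fun x => 'd f x v))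
  else forall x, U x -> {for x, continuous f}.

Definition smooth_on (R : realType) (V W : normedModType R) (U : set V)
    (f : V -> W) : Prop := forall k, Ck k U f.

(** * Manifolds *)

(* [achart_inv i] is only meaningful on the image of [adom i] under
   [achart i], and [achart i] is only meaningful on [adom i]. *)
Record atlas (R : realType) (T : Type) := Atlas {
  adim : nat;
  aindex : Type;
  adom : aindex -> set T;
  achart : aindex -> T -> 'rV[R]_adim;
  achart_inv : aindex -> 'rV[R]_adim -> T }.

(* The first conjunct says that f is continuous: it is imposed for all pairs
   of charts, and the second conjunct makes the chart expressions continuous. *)
Definition smooth_map (R : realType) (S T : Type) (A : atlas R S)
    (B : atlas R T) (f : S -> T) : Prop :=
  forall (i : aindex A) (j : aindex B),
    let U := achart i @` (adom i `&` f @^-1` adom j) in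
    open U /\ smooth_on U (achart j \o f \o achart_inv i).

Record manifold (R : realType) := Manifold {
  mcarrier :> topologicalType;
  matlas : atlas R mcarrier;
  (* a chart around each point *)
  chart_at : mcarrier -> aindex matlas;
  m_hausdorff : hausdorff_space mcarrier;
  m_second_countable : @second_countable mcarrier;
  mem_chart_at : forall p, adom (chart_at p) p;
  open_adom : forall i : aindex matlas, open (adom i);
  achartK : forall (i : aindex matlas) p,
    adom i p -> achart_inv i (achart i p) = p;
  achart_continuous : forall (i : aindex matlas) p,
    adom i p -> {for p, continuous (achart i)};
  achart_open : forall (i : aindex matlas) (U : set mcarrier),
    open U -> U `<=` adom i -> open (achart i @` U);
  achart_transition : forall i j : aindex matlas,
    smooth_on (achart i @` (adom i `&` adom j)) (achart j \o achart_inv i) }.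

Notation mindex M := (aindex (matlas M)).
Notation mdim M := (adim (matlas M)).

(* [U] is meant to be open. *)
Definition smooth_fun_on (R : realType) (M : manifold R) (W : normedModType R)
    (U : set M) (f : M -> W) : Prop :=
  forall i : mindex M,
    smooth_on (achart i @` (adom i `&` U)) (f \o achart_inv i).

(* C^oo(M, R) *)
Definition CI (R : realType) (M : manifold R) : set (M -> R) :=
  [set f | smooth_fun_on setT (f : M -> R^o)].
Arguments CI {R} M _.

Record diffeo (R : realType) (M N : manifold R) := Diffeo {
  dfun :> M -> N;
  dinv : N -> M;
  dfunK : cancel dfun dinv;
  dinvK : cancel dinv dfun;
  dfun_smooth : smooth_map (matlas M) (matlas N) dfun;
  dinv_smooth : smooth_map (matlas N) (matlas M) dinv }.

(** * Vector bundles *)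

(* The map [triv j p] is the fibre coordinate of the local trivialization of
   index [j]; it is only meaningful for [p] in [tdom j]. *)
Record prebundle (R : realType) (M : manifold R) := Prebundle {
  fiber : M -> lmodType R;
  rank : nat;
  tindex : Type;
  tdom : tindex -> set M;
  triv : tindex -> forall p, {linear fiber p -> 'rV[R]_rank} }.

Record vbundle (R : realType) (M : manifold R) := VBundle {
  vb_pre :> prebundle M;
  tdom_cover : forall p, exists j : tindex vb_pre, tdom j p;
  open_tdom : forall j : tindex vb_pre, open (tdom j);
  triv_bij : forall (j : tindex vb_pre) p, tdom j p -> bijective (triv j p);
  (* smooth transition functions with values in GL_rank *)
  triv_transition : forall j k : tindex vb_pre,
    exists g : M -> 'M[R]_(rank vb_pre),
      smooth_fun_on (tdom j `&` tdom k) g /\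
      forall p, tdom j p -> tdom k p ->
        forall e : fiber vb_pre p, triv k p e = triv j p e *m g p }.

Definition tot_space (R : realType) (M : manifold R) (E : prebundle M) :
    Type :=
  {p : M & fiber E p}.

(* the manifold structure of the total space *)
Definition total_atlas (R : realType) (M : manifold R) (E : prebundle M) :
    atlas R (tot_space E) :=
  @Atlas R (tot_space E) (mdim M + rank E) (mindex M * tindex E)%type
    (fun ij => [set e | adom ij.1 (projT1 e) /\ tdom ij.2 (projT1 e)])
    (fun ij e => row_mx (achart ij.1 (projT1 e))
                        (triv ij.2 (projT1 e) (projT2 e)))
    (fun ij x => let p := achart_inv ij.1 (lsubmx x) in
       existT _ p (xget 0 [set e : fiber E p | triv ij.2 p e = rsubmx x])).

(* set-theoretic sections *)
Definition rsection (R : realType) (M : manifold R) (E : prebundle M) : Type :=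
  forall p, fiber E p.

(* Gamma(E, M), the smooth sections *)
Definition Gamma (R : realType) (M : manifold R) (E : prebundle M) :
    set (rsection E) :=
  [set u | smooth_map (matlas M) (total_atlas E)
                      (fun p => existT _ p (u p) : tot_space E)].

Definition fiberwise (R : realType) (M M' : manifold R) (E : prebundle M)
    (E' : prebundle M') (phi0 : M -> M')
    (phi : forall p, fiber E p -> fiber E' (phi0 p)) :
    tot_space E -> tot_space E' :=
  fun e => existT _ (phi0 (projT1 e)) (phi (projT1 e) (projT2 e)).

Record vb_morphism (R : realType) (M M' : manifold R) (E : prebundle M)
    (E' : prebundle M') (phi0 : M -> M') := VBMorphism {
  vbm_fiber : forall p, {linear fiber E p -> fiber E' (phi0 p)};
  vbm_smooth : smooth_map (total_atlas E) (total_atlas E')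
    (fiberwise (fun p => vbm_fiber p)) }.

Definition vbm_total (R : realType) (M M' : manifold R) (E : prebundle M)
    (E' : prebundle M') (phi0 : M -> M') (phi : vb_morphism E E' phi0) :
    tot_space E -> tot_space E' := fiberwise (fun p => vbm_fiber phi p).

(* Gamma(phi, phi0) u = phi \o u \o phi0^-1, as a map into the total space *)
Definition pushforward (R : realType) (M M' : manifold R) (E : prebundle M)
    (E' : prebundle M') (phi : tot_space E -> tot_space E') (phi0_inv : M' -> M)
    (u : rsection E) : M' -> tot_space E' :=
  fun y => phi (existT _ (phi0_inv y) (u (phi0_inv y))).

(** * The tangent bundle *)

(* A tangent vector at p is its family of coordinates in all charts around p,
   related by the Jacobians of the transition maps; the entries at the charts
   that do not contain p are set to 0, so that equality of tangent vectors is
   equality of families. *)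
Section TangentSpace.
Variables (R : realType) (M : manifold R) (p : M).

Definition tangent_pred : {pred mindex M -> 'rV[R]_(mdim M)} :=
  fun v => `[< (forall i, ~ adom i p -> v i = 0) /\
               (forall i j, adom i p -> adom j p ->
                  v j = 'd (achart j \o achart_inv i) (achart i p) (v i)) >].

Fact tangent_submod_closed : submod_closed tangent_pred.
Proof.
split; first by apply/asboolP; split=> // i j _ _; rewrite linear0.
move=> a u v /asboolP[u0 uE] /asboolP[v0 vE]; apply/asboolP.
split=> [i pi|i j pi pj].
  by rewrite /= /GRing.add /GRing.scale /= u0 // v0 // scaler0 addr0.
transitivity (a *: u j + v j) => //.
by rewrite (uE i j pi pj) (vE i j pi pj) -linearP.
Qed.

HB.instance Definition _ := GRing.isSubmodClosed.Build R
  (mindex M -> 'rV[R]_(mdim M)) tangent_pred tangent_submod_closed.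

Record tangent_space := TangentVector {
  tvcoord :> mindex M -> 'rV[R]_(mdim M);
  _ : tvcoord \in tangent_pred }.

HB.instance Definition _ := [isSub for tvcoord].
HB.instance Definition _ := [Choice of tangent_space by <:].
HB.instance Definition _ :=
  [SubChoice_isSubLmodule of tangent_space by <:].

Definition tangent_coord (i : mindex M) (v : tangent_space) :
  'rV[R]_(mdim M) := v i.

Fact tangent_coord_linear i : linear (tangent_coord i).
Proof. by []. Qed.

HB.instance Definition _ i :=
  GRing.isLinear.Build R tangent_space 'rV[R]_(mdim M) *:%R
    (tangent_coord i) (tangent_coord_linear i).

End TangentSpace.

Definition tangent (R : realType) (M : manifold R) : prebundle M :=
  @Prebundle R M (fun p => tangent_space p : lmodType R) (mdim M) (mindex M)
    (fun i => adom i) (fun i p => tangent_coord i).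

(* Th : TM -> TN.  The tangent vector described by [xget] is the unique one
   with the given coordinates; it exists when h is smooth. *)
Definition tangent_map (R : realType) (M N : manifold R) (h : M -> N) :
    tot_space (tangent M) -> tot_space (tangent N) :=
  @fiberwise R M N (tangent M) (tangent N) h (fun p (w : tangent_space p) =>
    xget (0 : tangent_space (h p)) [set w' : tangent_space (h p) |
      forall (i : mindex M) (j : mindex N), adom i p -> adom j (h p) ->
        w' j = 'd (achart j \o h \o achart_inv i) (achart i p) (w i)]).

(* The derivative of f along a tangent vector; the choice of the chart around
   the base point is immaterial. *)
Definition tangent_act (R : realType) (N : manifold R)
    (w : tot_space (tangent N)) (f : N -> R) : R :=
  let i := chart_at (projT1 w) in
  'd ((f : N -> R^o) \o achart_inv i) (achart i (projT1 w))
     ((projT2 w : tangent_space (projT1 w)) i).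

(* X(f), for a vector field X given as a map into the total space of TN *)
Definition vf_act (R : realType) (N : manifold R)
    (X : N -> tot_space (tangent N)) (f : N -> R) :
    N -> R := fun p => tangent_act (X p) f.

(* Z is the Lie bracket of the vector fields X and Y *)
Definition is_lie_bracket (R : realType) (N : manifold R)
    (X Y Z : N -> tot_space (tangent N)) : Prop :=
  forall f, CI N f ->
    vf_act Z f = vf_act X (vf_act Y f) \- vf_act Y (vf_act X f).

(** * Generalized Lie algebroids *)

(* Gamma(Th \o rho, h \o eta) *)
Definition anchor_of (R : realType) (M N : manifold R) (h : diffeo M N)
    (eta : diffeo N M) (F : prebundle N)
    (rho : vb_morphism F (tangent M) eta) (u : rsection F) :
    N -> tot_space (tangent N) :=
  pushforward (tangent_map h \o vbm_total rho) (dinv eta \o dinv h) u.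

(* The bracket is only constrained (and only used) on smooth sections.
   The R-linearity of the anchor on sections is automatic, as rho and Th are
   linear on the fibres. *)
Record gen_lie_algebroid (R : realType) := GenLieAlgebroid {
  glaM : manifold R;
  glaN : manifold R;
  glah : diffeo glaM glaN;
  glaeta : diffeo glaN glaM;
  glaF : vbundle glaN;
  glarho : vb_morphism glaF (tangent glaM) glaeta;
  gbr : rsection glaF -> rsection glaF -> rsection glaF;
  gbr_Gamma : forall u v, Gamma u -> Gamma v -> Gamma (gbr u v);
  gbr_leibniz : forall u v f, Gamma u -> Gamma v -> CI glaN f ->
    forall p, gbr u (fun p => f p *: v p) p =
      f p *: gbr u v p + vf_act (anchor_of glah glarho u) f p *: v p;
  gbr_linearl : forall (a : R) u v w, Gamma u -> Gamma v -> Gamma w ->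
    forall p, gbr (fun p => a *: u p + v p) w p = a *: gbr u w p + gbr v w p;
  gbr_linearr : forall (a : R) u v w, Gamma u -> Gamma v -> Gamma w ->
    forall p, gbr w (fun p => a *: u p + v p) p = a *: gbr w u p + gbr w v p;
  gbr_antisym : forall u v, Gamma u -> Gamma v ->
    forall p, gbr u v p = - gbr v u p;
  gbr_jacobi : forall u v w, Gamma u -> Gamma v -> Gamma w ->
    forall p, gbr u (gbr v w) p + gbr v (gbr w u) p + gbr w (gbr u v) p = 0;
  gbr_anchor : forall u v, Gamma u -> Gamma v ->
    is_lie_bracket (anchor_of glah glarho u) (anchor_of glah glarho v)
                   (anchor_of glah glarho (gbr u v)) }.

(** * Exterior calculus *)

Section ExteriorCalculus.
Variables (R : realType) (A : gen_lie_algebroid R).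
Notation N := (glaN A).
Notation F := (glaF A).

(* Gamma(Th \o rho, h \o eta) z (f) *)
Definition anchor_act (z : rsection F) (f : N -> R) : N -> R :=
  vf_act (anchor_of (glah A) (glarho A) z) f.

(* A q-form is represented by a map defined on q-tuples of set-theoretic
   sections, of which only the values on q-tuples of smooth sections matter:
   see [Lambda] and [form_eq]. *)
Definition preform (q : nat) : Type := ('I_q -> rsection F) -> (N -> R).

Definition Gammas (q : nat) : set ('I_q -> rsection F) :=
  [set z | forall i, Gamma (z i)].

(* equality of the restrictions to Gamma(F, nu, N)^q *)
Definition form_eq (q : nat) (w w' : preform q) : Prop :=
  forall z, Gammas z -> w z = w' z.

(* Lambda^q(F, nu, N) *)
Definition Lambda (q : nat) : set (preform q) := [set w |
  [/\ forall z, Gammas z -> CI N (w z),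
      forall z i u v f, Gammas z -> Gamma u -> Gamma v -> CI N f ->
        w [eta z with i |-> (fun p => f p *: u p + v p)] =
        f \* w [eta z with i |-> u] \+ w [eta z with i |-> v]
    & forall z i j, Gammas z -> i != j -> z i = z j -> w z = cst 0]].

Definition wedge (q r : nat) (w : preform q) (t : preform r) :
    preform (q + r) :=
  fun z p => (q`! * r`!)%:R^-1 *
    \sum_(s : 'S_(q + r)) (-1) ^+ s *
      w (fun i => z (s (lshift r i))) p * t (fun j => z (s (rshift q j))) p.

(* For q = 0 the sum is empty, and this is L_z f = Gamma(Th o rho, h o eta)z(f)
   under the identification of 0-forms with functions. *)
Definition Lie (z : rsection F) (q : nat) (w : preform q) : preform q :=
  fun zs p => anchor_act z (w zs) p -
    \sum_(i < q) w [eta zs with i |-> gbr z (zs i)] p.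

(* For i < j, the k-th term of the sequence 0, 1, 2, ... with i and j removed
   is bump j (bump i k). *)
Definition dF (q : nat) (w : preform q) : preform q.+1 :=
  fun z p =>
    \sum_(i < q.+1)
      (-1) ^+ i * anchor_act (z i) (w (fun k => z (lift i k))) p +
    \sum_(i < q.+1) \sum_(j < q.+1 | (i < j)%N)
      (-1) ^+ (i + j) *
      w (fun k => if k == 0%N :> nat then gbr (z i) (z j)
                  else z (inord (bump j (bump i k.-1)))) p.

End ExteriorCalculus.

(* Main.v *)
(** A form is an alternating function, so it is determined by its values on
lists of sections, its degree being the length of the list on which it does not
vanish.  On such functions the interior product [insert x] prepends [x], and
Cartan's formula [insert x (d w) = L_x w - d (insert x w)] together with
[insert y (L_x w) = L_x (insert y w) - insert [x, y] w] and the antiderivation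
rule for [insert x] on exterior products can be taken as recursive definitions
of d, L and the wedge.  All three identities then follow by induction on the
list.  Antisymmetry shows that the closed formulas defining
[dF], [Lie] and [wedge] satisfy the recursions.
The identities of order two apply the anchor to a function that is itself of
the form X(f) with f smooth; the only analysis needed for this is that X(f) is
differentiable. *)

From HB Require Import structures.
From mathcomp Require Import all_boot all_order all_algebra all_fingroup.
From mathcomp Require Import zify ring.
From mathcomp Require Import all_classical all_reals.
From mathcomp Require Import topology normedtype landau derive.
(* Last, so that [dinv] is not shadowed by the one of derive. *)
Require Import Defs.

Set Implicit Arguments.
Unset Strict Implicit.
Unset Printing Implicit Defensive.

Import Order.TTheory GRing.Theory Num.Theory.
Import numFieldNormedType.Exports.

Local Open Scope classical_set_scope.
Local Open Scope ring_scope.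

Lemma app_fctD (T : Type) (V : zmodType) (f g : T -> V) x :
  (f + g) x = f x + g x.
Proof. by []. Qed.

Lemma app_fctN (T : Type) (V : zmodType) (f : T -> V) x : (- f) x = - f x.
Proof. by []. Qed.

Definition appE := (app_fctD, app_fctN).

(** * The calculus on lists of sections *)

Section ListForms.
Variables (K : comPzRingType) (G : Type).
Variables (br : G -> G -> G) (rho : G -> K -> K).

Definition insert (x : G) (w : seq G -> K) : seq G -> K := fun s => w (x :: s).

Fixpoint lieL (x : G) (w : seq G -> K) (s : seq G) {struct s} : K :=
  if s is y :: s' then lieL x (insert y w) s' - w (br x y :: s')
  else rho x (w [::]).

Fixpoint difL (w : seq G -> K) (s : seq G) {struct s} : K :=
  if s is x :: s' then lieL x w s' - difL (insert x w) s' else 0.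

(** The grading involution: it multiplies a function of degree q by $(-1)^q$, so the antiderivation
    rules need not mention degrees. *)
Definition signL (w : seq G -> K) : seq G -> K :=
  fun s => (-1) ^+ size s * w s.

Fixpoint wedL (w t : seq G -> K) (s : seq G) {struct s} : K :=
  if s is x :: s' then wedL (insert x w) t s' + wedL (signL w) (insert x t) s'
  else w [::] * t [::].

(** * Insertion, signs and bilinearity of the exterior product *)

Lemma insertD x w t : insert x (w + t) = insert x w + insert x t.
Proof. by []. Qed.

Lemma insertN x w : insert x (- w) = - insert x w.
Proof. by []. Qed.

Lemma insert_signL x w : insert x (signL w) = - signL (insert x w).
Proof.
by apply/funext => s; rewrite /insert /signL !appE /= exprS mulN1r mulNr.
Qed.

Lemma signLK w : signL (signL w) = w.
Proof.
by apply/funext => s; rewrite /signL mulrA -signr_odd -expr2 sqrr_sign mul1r.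
Qed.

Lemma signLN w : signL (- w) = - signL w.
Proof. by apply/funext => s; rewrite /signL !appE mulrN. Qed.

Lemma signLD w t : signL (w + t) = signL w + signL t.
Proof. by apply/funext => s; rewrite /signL !appE mulrDr. Qed.

(** This and the next two lemmas turn the recursions into identities between functions, which can be
    rewritten under further operators. *)
Lemma insert_lieL x y w :
  insert y (lieL x w) = lieL x (insert y w) - insert (br x y) w.
Proof. by []. Qed.

Lemma insert_difL x w : insert x (difL w) = lieL x w - difL (insert x w).
Proof. by []. Qed.

Lemma insert_wedL x w t :
  insert x (wedL w t) = wedL (insert x w) t + wedL (signL w) (insert x t).
Proof. by []. Qed.

Lemma wedLDl w w' t : wedL (w + w') t = wedL w t + wedL w' t.
Proof.
apply/funext => s; rewrite appE; elim: s w w' t => [|x s IH] w w' t /=.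
  by rewrite !appE mulrDl.
by rewrite insertD signLD !IH; ring.
Qed.

Lemma wedLDr w t t' : wedL w (t + t') = wedL w t + wedL w t'.
Proof.
apply/funext => s; rewrite appE; elim: s w t t' => [|x s IH] w t t' /=.
  by rewrite !appE mulrDr.
by rewrite insertD !IH; ring.
Qed.

Lemma wedLNl w t : wedL (- w) t = - wedL w t.
Proof.
apply/funext => s; rewrite appE; elim: s w t => [|x s IH] w t /=.
  by rewrite !appE mulNr.
by rewrite insertN signLN !IH; ring.
Qed.

Lemma wedLNr w t : wedL w (- t) = - wedL w t.
Proof.
apply/funext => s; rewrite appE; elim: s w t => [|x s IH] w t /=.
  by rewrite !appE mulrN.
by rewrite insertN !IH; ring.
Qed.

(* [D1] stands for differentiable functions and [D2] for smooth ones. *)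
Variables (D1 D2 : K -> Prop).
Hypothesis D1_1 : D1 1.
Hypothesis D1B : forall a b, D1 a -> D1 b -> D1 (a - b).
Hypothesis D1M : forall a b, D1 a -> D1 b -> D1 (a * b).
Hypothesis D2_D1 : forall a, D2 a -> D1 a.
Hypothesis rhoB :
  forall x a b, D1 a -> D1 b -> rho x (a - b) = rho x a - rho x b.
Hypothesis rhoM :
  forall x a b, D1 a -> D1 b -> rho x (a * b) = rho x a * b + a * rho x b.
Hypothesis rhoD2 : forall x a, D2 a -> D1 (rho x a).
Hypothesis rho_br : forall x y a, D2 a ->
  rho (br x y) a = rho x (rho y a) - rho y (rho x a).

Lemma D1_0 : D1 0.
Proof. by rewrite -(subrr 1); apply: D1B. Qed.

Lemma D1N a : D1 a -> D1 (- a).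
Proof. by rewrite -sub0r; apply: D1B => //; apply: D1_0. Qed.

Lemma D1D a b : D1 a -> D1 b -> D1 (a + b).
Proof. by move=> Da Db; rewrite -[b]opprK; apply: D1B => //; apply: D1N. Qed.

Lemma rho0 x : rho x 0 = 0.
Proof. by rewrite -{1}(subrr 0) rhoB ?subrr //; apply: D1_0. Qed.

Lemma rhoN x a : D1 a -> rho x (- a) = - rho x a.
Proof. by move=> Da; rewrite -sub0r rhoB ?rho0 ?sub0r //; apply: D1_0. Qed.

Lemma rhoD x a b : D1 a -> D1 b -> rho x (a + b) = rho x a + rho x b.
Proof.
by move=> Da Db; rewrite -{1}[b]opprK rhoB ?rhoN ?opprK //; apply: D1N.
Qed.

(** * Regularity, and additivity of the Lie derivative and the differential *)

Definition diffL (w : seq G -> K) := forall s, D1 (w s).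
Definition smoothL (w : seq G -> K) := forall s, D2 (w s).

Lemma smoothL_diffL w : smoothL w -> diffL w.
Proof. by move=> Dw s; apply: D2_D1. Qed.

Lemma diffL_insert x w : diffL w -> diffL (insert x w).
Proof. by move=> Dw s; apply: Dw. Qed.

Lemma smoothL_insert x w : smoothL w -> smoothL (insert x w).
Proof. by move=> Dw s; apply: Dw. Qed.

Lemma diffLN w : diffL w -> diffL (- w).
Proof. by move=> Dw s; apply: D1N. Qed.

Lemma diffL_signL w : diffL w -> diffL (signL w).
Proof.
move=> Dw s; rewrite /signL -signr_odd; case: odd; last by rewrite mul1r.
by rewrite mulN1r; apply: D1N.
Qed.

Lemma diffL_wedL w t : diffL w -> diffL t -> diffL (wedL w t).
Proof.
move=> Dw Dt s; elim: s w t Dw Dt => [|x s IH] w t Dw Dt /=.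
  exact: D1M.
by apply: D1D; apply: IH => //; do ?[apply: diffL_insert|apply: diffL_signL].
Qed.

Lemma diffL_lieL x w : smoothL w -> diffL (lieL x w).
Proof.
move=> Dw s; elim: s w Dw => [|y s IH] w Dw /=; first exact: rhoD2.
by apply: D1B; [apply: IH; apply: smoothL_insert | apply: D2_D1].
Qed.

Lemma diffL_difL w : smoothL w -> diffL (difL w).
Proof.
move=> Dw s; elim: s w Dw => [|y s IH] w Dw /=; first exact: D1_0.
by apply: D1B; [apply: diffL_lieL | apply: IH; apply: smoothL_insert].
Qed.

Lemma lieLD x w t : diffL w -> diffL t -> lieL x (w + t) = lieL x w + lieL x t.
Proof.
move=> Dw Dt; apply/funext => s; rewrite appE.
elim: s w t Dw Dt => [|y s IH] w t Dw Dt /=; first exact: rhoD.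
rewrite insertD IH; [|exact: diffL_insert..].
by rewrite !appE; ring.
Qed.

Lemma lieLN x w : diffL w -> lieL x (- w) = - lieL x w.
Proof.
move=> Dw; apply/funext => s; rewrite appE.
elim: s w Dw => [|y s IH] w Dw /=; first exact: rhoN.
by rewrite insertN IH; [rewrite !appE; ring|exact: diffL_insert].
Qed.

Lemma lieLB x w t : diffL w -> diffL t -> lieL x (w - t) = lieL x w - lieL x t.
Proof. by move=> Dw Dt; rewrite lieLD ?lieLN //; exact: diffLN. Qed.

Lemma lieL0 x : lieL x 0 = 0.
Proof.
have D0 : diffL 0 by move=> s; exact: D1_0.
by rewrite -[X in lieL x X](subrr 0) lieLB // subrr.
Qed.

Lemma difLD w t : diffL w -> diffL t -> difL (w + t) = difL w + difL t.
Proof.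
move=> Dw Dt; apply/funext => s; rewrite appE.
elim: s w t Dw Dt => [|y s IH] w t Dw Dt /=; first by rewrite addr0.
rewrite insertD IH; [|exact: diffL_insert..].
by rewrite lieLD // !appE; ring.
Qed.

Lemma difLN w : diffL w -> difL (- w) = - difL w.
Proof.
move=> Dw; apply/funext => s; rewrite appE.
elim: s w Dw => [|y s IH] w Dw /=; first by rewrite oppr0.
by rewrite insertN IH ?lieLN //; [rewrite !appE; ring|exact: diffL_insert].
Qed.

Lemma difLB w t : diffL w -> diffL t -> difL (w - t) = difL w - difL t.
Proof. by move=> Dw Dt; rewrite difLD ?difLN //; exact: diffLN. Qed.

(** * Signs and Leibniz rules *)

Lemma signL_lieL x w : diffL w -> signL (lieL x w) = lieL x (signL w).
Proof.
move=> Dw; apply/funext => s; elim: s w Dw => [|y s IH] w Dw.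
  by rewrite /signL /= !expr0 !mul1r.
rewrite -[LHS]/(insert y _ s) insert_signL insert_lieL signLD signLN /=.
have Di := diffL_insert y Dw.
rewrite !appE IH // insert_signL lieLN; last exact: diffL_signL.
by rewrite -[signL w _]/(insert (br x y) (signL w) s) insert_signL !appE; ring.
Qed.

(** The differential raises the degree by one, hence the minus sign. *)
Lemma signL_difL w : diffL w -> signL (difL w) = - difL (signL w).
Proof.
move=> Dw; apply/funext => s; elim: s w Dw => [|x s IH] w Dw.
  by rewrite /signL appE /= mulr0 oppr0.
rewrite -[LHS]/(insert x _ s) insert_signL insert_difL signLD signLN /=.
have Di := diffL_insert x Dw.
rewrite !appE IH //= insert_signL difLN; last exact: diffL_signL.
by rewrite signL_lieL // !appE; ring.
Qed.

(** On the empty list this is the derivation property of [rho x]. Inserting y on both sides leaves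
    two instances of the induction hypothesis and the same terms in $[x,y]$. *)
Lemma lieL_wedL x w t : diffL w -> diffL t ->
  lieL x (wedL w t) = wedL (lieL x w) t + wedL w (lieL x t).
Proof.
move=> Dw Dt; apply/funext => s; rewrite appE.
elim: s w t Dw Dt => [|y s IH] w t Dw Dt /=; first exact: rhoM.
have [iw it sw] : [/\ diffL (insert y w), diffL (insert y t) & diffL (signL w)].
  by split; [exact: diffL_insert|exact: diffL_insert|exact: diffL_signL].
rewrite insert_wedL lieLD; [|exact: diffL_wedL..].
rewrite !appE !IH // !insert_lieL signL_lieL // !wedLDl !wedLDr !wedLNl !wedLNr.
by rewrite !appE; ring.
Qed.

(** Inserting x turns d into $L_x - d\,i_x$. The Leibniz rule handles $L_x$, and the induction
    hypothesis handles the two products that make up $i_x(w \wedge t)$. *)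
Theorem difL_wedL w t : diffL w -> diffL t ->
  difL (wedL w t) = wedL (difL w) t + wedL (signL w) (difL t).
Proof.
move=> Dw Dt; apply/funext => s; rewrite appE.
elim: s w t Dw Dt => [|x s IH] w t Dw Dt /=; first by rewrite mul0r mulr0 addr0.
have [iw it sw] : [/\ diffL (insert x w), diffL (insert x t) & diffL (signL w)].
  by split; [exact: diffL_insert|exact: diffL_insert|exact: diffL_signL].
rewrite insert_wedL difLD; [|exact: diffL_wedL..].
rewrite !appE !IH // lieL_wedL // signLK insert_signL signL_difL //.
rewrite !insert_difL.
by rewrite !wedLDl !wedLDr !wedLNl !wedLNr !appE; ring.
Qed.

(** [G] carries no addition, so the Jacobi identity, in its derivation form, is expressed through
    the values of w. *)
Definition jacobiL (w : seq G -> K) := forall s1 s2 x y z,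
  w (s1 ++ br (br x y) z :: s2) =
  w (s1 ++ br x (br y z) :: s2) - w (s1 ++ br y (br x z) :: s2).

Lemma jacobiL_insert x w : jacobiL w -> jacobiL (insert x w).
Proof. by move=> Jw s1; apply: Jw (x :: s1). Qed.

(** On the empty list this is [rho_br]. When z is inserted, the mixed terms of the commutator cancel
    and the remaining double brackets match by the Jacobi identity. *)
Lemma lieL_br x y w : smoothL w -> jacobiL w ->
  lieL (br x y) w = lieL x (lieL y w) - lieL y (lieL x w).
Proof.
move=> Dw Jw; apply/funext => s; rewrite !appE.
elim: s w Dw Jw => [|z s IH] w Dw Jw /=; first exact: rho_br.
have iw := smoothL_insert z Dw.
rewrite IH //; last exact: jacobiL_insert.
have iL u v v' : diffL (insert u w) /\ diffL (lieL v (insert v' w)).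
  by split; [apply: smoothL_diffL|apply: diffL_lieL]; apply: smoothL_insert.
rewrite !insert_lieL !lieLB; try by case: (iL (br y z) y z).
all: try by case: (iL (br x z) x z).
by rewrite (Jw [::] s x y z) !appE /= /insert; ring.
Qed.

(** After inserting y and applying Cartan's formula on both sides, what remains is the induction
    hypothesis for $i_y w$ and $L_{[x,y]} = [L_x, L_y]$. *)
Theorem lieL_difL x w : smoothL w -> jacobiL w ->
  lieL x (difL w) = difL (lieL x w).
Proof.
move=> Dw Jw; apply/funext => s.
elim: s w Dw Jw => [|y s IH] w Dw Jw /=; first exact: rho0.
have iw := smoothL_insert y Dw.
rewrite insert_difL insert_lieL lieLB; [|exact: diffL_lieL|exact: diffL_difL].
rewrite difLB; [|exact: diffL_lieL|by apply/smoothL_diffL/smoothL_insert].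
rewrite !appE IH //; last exact: jacobiL_insert.
by rewrite lieL_br // !appE; ring.
Qed.

(** Cartan's formula gives $i_x d d w = L_x d w - d L_x w + d d\, i_x w$: the first two terms
    cancel, and the last vanishes by induction. *)
Theorem difL_difL w s : smoothL w -> jacobiL w -> difL (difL w) s = 0.
Proof.
elim: s w => [//|x s IH] w Dw Jw /=.
have iw := smoothL_insert x Dw.
rewrite insert_difL difLB; [|exact: diffL_lieL|exact: diffL_difL].
rewrite !appE lieL_difL // IH //; last exact: jacobiL_insert.
by rewrite subr0 subrr.
Qed.

(** Forms will be extended by zero to lists of the wrong length; homogeneity settles the identities
    on those lists. *)
Definition homogL q (w : seq G -> K) := forall s, size s != q -> w s = 0.

Lemma homogL_insert q x w : homogL q.+1 w -> homogL q (insert x w).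
Proof. by move=> hw s sz; apply: hw. Qed.

Lemma homogL_insert0 x w : homogL 0 w -> insert x w = 0.
Proof. by move=> hw; apply/funext => s; apply: hw. Qed.

Lemma homogL_lieL q x w : homogL q w -> homogL q (lieL x w).
Proof.
move=> hw s; elim: s q w hw => [|y s IH] [|q] w hw //= sz.
- by rewrite hw // rho0.
- by rewrite hw // subr0 homogL_insert0 // lieL0.
- by rewrite hw // subr0 (IH q) //; exact: homogL_insert.
Qed.

Lemma difL0 : difL 0 = 0.
Proof.
have D0 : diffL 0 by move=> s; exact: D1_0.
by rewrite -[X in difL X](subrr 0) difLB // subrr.
Qed.

Lemma homogL_difL q w : homogL q w -> homogL q.+1 (difL w).
Proof.
move=> hw s; elim: s q w hw => [|y s IH] [|q] w hw //= sz.
- by rewrite (homogL_lieL _ hw) // sub0r homogL_insert0 // difL0 oppr0.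
- rewrite (homogL_lieL _ hw) // sub0r (IH q) ?oppr0 //.
  exact: homogL_insert.
Qed.

Definition antisymL (w : seq G -> K) := forall s1 x y s2,
  w (s1 ++ x :: y :: s2) = - w (s1 ++ y :: x :: s2).

(** As with [jacobiL], antisymmetry of the bracket is seen only through the values of w. *)
Definition skew_brL (w : seq G -> K) := forall s1 x y s2,
  w (s1 ++ br x y :: s2) = - w (s1 ++ br y x :: s2).

Lemma antisymL_insert x w : antisymL w -> antisymL (insert x w).
Proof. by move=> Aw s1; apply: Aw (x :: s1). Qed.

Lemma skew_brL_insert x w : skew_brL w -> skew_brL (insert x w).
Proof. by move=> Aw s1; apply: Aw (x :: s1). Qed.

Lemma insertC x y w : antisymL w ->
  insert x (insert y w) = - insert y (insert x w).
Proof. by move=> Aw; apply/funext => s; exact: Aw [::] y x s. Qed.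

Lemma antisymL_lieL x w : diffL w -> antisymL w -> antisymL (lieL x w).
Proof.
move=> Dw Aw s1; elim: s1 w Dw Aw => [|c s1 IH] w Dw Aw a b s2 /=; last first.
  rewrite IH; [|exact: diffL_insert|exact: antisymL_insert].
  by rewrite -[w _]/(w ((_ :: s1) ++ _)) Aw /=; ring.
rewrite (insertC _ _ Aw) lieLN; last by do 2!apply: diffL_insert.
by rewrite !appE /insert (Aw [::] (br x b)) (Aw [::] (br x a)) /=; ring.
Qed.

(** In the first two entries, the Lie terms are exchanged, the bracket term changes sign by
    [skew_brL], and the last term does because insertions anticommute. *)
Lemma antisymL_difL w : smoothL w -> antisymL w -> skew_brL w ->
  antisymL (difL w).
Proof.
move=> Dw Aw Sw s1; elim: s1 w Dw Aw Sw => [|c s1 IH] w Dw Aw Sw a b s2 /=.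
  have iw u : smoothL (insert u w) by exact: smoothL_insert.
  rewrite (insertC _ _ Aw) difLN; last first.
    by do 2!apply: diffL_insert; apply: smoothL_diffL.
  by rewrite !appE (Sw [::] a b) /=; ring.
rewrite antisymL_lieL //; last exact: smoothL_diffL.
rewrite IH; first ring.
- exact: smoothL_insert.
- exact: antisymL_insert.
- exact: skew_brL_insert.
Qed.

Lemma antisymL_signL w : antisymL w -> antisymL (signL w).
Proof.
by move=> Aw s1 a b s2; rewrite /signL Aw mulrN !size_cat.
Qed.

(** Two insertions give a term with both in w, a term with both in t, and two mixed terms. The mixed
    ones are exchanged up to sign, since insertion anticommutes with [signL]. *)
Lemma antisymL_wedL w t : antisymL w -> antisymL t -> antisymL (wedL w t).
Proof.
move=> Aw At s1; elim: s1 w t Aw At => [|c s1 IH] w t Aw At a b s2 /=.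
  rewrite (insertC _ _ Aw) (insertC _ _ At) !insert_signL signLK.
  by rewrite !wedLNl !wedLNr !appE; ring.
rewrite [X in X + _ = _]IH; [|exact: antisymL_insert|done].
rewrite [X in _ + X = _]IH; [|exact: antisymL_signL|exact: antisymL_insert].
ring.
Qed.

End ListForms.

(** * Closed formulas *)

Definition cut (T : Type) (i : nat) (s : seq T) := take i s ++ drop i.+1 s.

Lemma nth_cut (T : Type) (x0 : T) i k s : (i < size s)%N ->
  nth x0 (cut i s) k = nth x0 s (bump i k).
Proof.
move=> ltis; rewrite nth_cat size_takel ?(ltnW ltis) // /bump.
case: ltnP => [ki|ik]; first by rewrite nth_take.
by rewrite nth_drop add1n addSn subnKC.
Qed.

Lemma size_cut (T : Type) i (s : seq T) : (i < size s)%N ->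
  size (cut i s) = (size s).-1.
Proof.
move=> ltis; rewrite size_cat size_takel ?(ltnW ltis) // size_drop.
by rewrite subnS; case: (size s) ltis => // n lein; rewrite -subnS subSS subnKC.
Qed.

Definition splice (T : Type) k (x : T) (s : seq T) := take k s ++ x :: drop k s.

Lemma mktuple_splice (T : Type) n (z : 'I_n.+1 -> T) (k : 'I_n.+1) :
  [tuple z i | i < n.+1] = splice k (z k) [tuple z (lift k i) | i < n] :> seq T.
Proof.
have kn : (k <= n)%N by rewrite -ltnS.
have szk : size (take k [tuple z (lift k i) | i < n]) = k.
  by rewrite size_takel // size_tuple.
apply: (@eq_from_nth _ (z k)) => [|i].
  rewrite size_tuple /splice size_cat szk -[size (_ :: _)]/(size (drop _ _)).+1.
  by rewrite size_drop size_tuple addnS subnKC.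
rewrite size_tuple => lti.
rewrite (nth_mktuple _ _ (Ordinal lti)) nth_cat szk.
(* A position is either k itself or [lift k j]; in the latter case it lies after k exactly when k <=
   j. *)
case: (unliftP k (Ordinal lti)) => [j|] e; have /= ej := congr1 val e;
  rewrite e ej; last by rewrite ltnn subnn.
have [kj|jk] := leqP k j.
  have -> : bump k j = j.+1 by rewrite /bump kj.
  by rewrite ltnNge leqW //= subSn //= nth_drop subnKC // nth_mktuple.
have -> : bump k j = j by rewrite /bump leqNgt jk.
by rewrite jk nth_take // nth_mktuple.
Qed.

(** [lift_perm k ord0 s] sends k to [ord0] and permutes the rest by s. Both k and s can be recovered
    from it, and counting does the rest. *)
Lemma lift_perm_bij n :
  bijective (fun ks : 'I_n.+1 * 'S_n => lift_perm ks.1 ord0 ks.2).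
Proof.
apply: inj_card_bij => [[k s] [k' s'] /= e|]; last first.
  by rewrite card_prod !card_ord !card_Sn.
have ek : k = k'.
  apply: (@perm_inj _ (lift_perm k ord0 s)).
  by rewrite lift_perm_id e lift_perm_id.
rewrite -ek in e *; congr pair; apply/permP => i.
by apply: (@lift_inj _ ord0); rewrite -!(lift_perm_lift k) e.
Qed.

Section ClosedFormulas.
Variables (K : comPzRingType) (G : Type).
Implicit Types (w t : seq G -> K) (s : seq G).

Lemma antisymL_front w s1 y s2 : antisymL w ->
  w (s1 ++ y :: s2) = (-1) ^+ size s1 * w (y :: s1 ++ s2).
Proof.
move=> Aw; elim: s1 w Aw => [|x s1 IH] w Aw /=; first by rewrite mul1r.
rewrite -[LHS]/(insert x w (s1 ++ y :: s2)) IH; last exact: antisymL_insert.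
by rewrite /insert (Aw [::] x y) exprS mulrN mulN1r mulNr.
Qed.

Lemma lieL_sum br (rho : G -> K -> K) x0 x w s :
  lieL br rho x w s =
  rho x (w s) - \sum_(i < size s) w (set_nth x0 s i (br x (nth x0 s i))).
Proof.
elim: s w => [|y s IH] w /=; first by rewrite big_ord0 subr0.
rewrite IH big_ord_recl /insert; under [in RHS]eq_bigr do rewrite lift0.
by rewrite /=; ring.
Qed.

Lemma sum_ord_recl_gt n i (F : nat -> K) :
  \sum_(j < n.+1 | (i < j)%N) F j = \sum_(j < n | (i <= j)%N) F j.+1.
Proof. by rewrite [LHS]big_mkcond [RHS]big_mkcond big_ord_recl /= add0r. Qed.

(** The terms with i = 0 come from the Lie derivative along the head of the list, those with i > 0
    from the differential of the insertion. *)
Lemma difL_sum br (rho : G -> K -> K) x0 w s : antisymL w ->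
  difL br rho w s =
  \sum_(i < size s) (-1) ^+ i * rho (nth x0 s i) (w (cut i s)) +
  \sum_(i < size s) \sum_(j < size s | (i < j)%N)
    (-1) ^+ (i + j) * w (br (nth x0 s i) (nth x0 s j) :: cut i (cut j s)).
Proof.
elim: s w => [|x s IH] w Aw; first by rewrite !big_ord0 addr0.
rewrite [LHS]/= IH; last exact: antisymL_insert.
rewrite (lieL_sum _ _ x0) [size (x :: s)]/= ![in RHS]big_ord_recl.
rewrite (sum_ord_recl_gt _ 0 (fun j => (-1) ^+ (0 + j) *
  w (br (nth x0 (x :: s) 0) (nth x0 (x :: s) j) :: cut 0 (cut j (x :: s))))).
under [X in _ = _ + X + _]eq_bigr do rewrite lift0.
have cut0 u : cut 0 (x :: u) = u by rewrite /cut /= drop0.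
(* The bracket in position i moves to the front across i entries, which costs $(-1)^i$. *)
have -> : \sum_(i < size s) w (set_nth x0 s i (br x (nth x0 s i))) =
  - \sum_(i < size s) (-1) ^+ (0 + i.+1) * w (br (nth x0 (x :: s) 0)
       (nth x0 (x :: s) i.+1) :: cut 0 (cut i.+1 (x :: s))).
  rewrite -sumrN; apply: eq_bigr => i _; rewrite set_nthE ltn_ord cut0.
  rewrite antisymL_front // size_takel ?(ltnW (ltn_ord i)) //.
  by rewrite add0n exprS mulN1r mulNr opprK.
have -> : \sum_(i < size s) (-1) ^+ i * rho (nth x0 s i) (insert x w (cut i s))
  = - \sum_(i < size s) (-1) ^+ i.+1 * rho (nth x0 (x :: s) i.+1)
       (w (cut i.+1 (x :: s))).
  by rewrite -sumrN; apply: eq_bigr => i _; rewrite exprS mulN1r mulNr opprK.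
rewrite expr0 mul1r [nth _ _ ord0]/= cut0 opprD !opprK !addrA.
rewrite [X in X - _]addrAC; congr (_ + _ + _ + _).
(* Shifting both i and j leaves the sign unchanged; the outer minus sign is absorbed by exchanging x
   with the bracket in front. *)
rewrite -sumrN; apply: eq_bigr => i _.
rewrite lift0 (sum_ord_recl_gt _ _ (fun j => (-1) ^+ (i.+1 + j) *
  w (br (nth x0 (x :: s) i.+1) (nth x0 (x :: s) j) ::
     cut i.+1 (cut j (x :: s))))).
rewrite -sumrN; apply: eq_bigr => j _.
by rewrite addSn addnS !exprS /insert (Aw [::] x) /=; ring.
Qed.

(** Antisymmetrization without normalizing factor: the shape of the sum in [wedge]. *)
Definition altL n (f : seq G -> K) (z : 'I_n -> G) : K :=
  \sum_(s : 'S_n) (-1) ^+ s * f [tuple z (s i) | i < n].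

Lemma altL_ext n f g (z : 'I_n -> G) :
  (forall s, size s = n -> f s = g s) -> altL f z = altL g z.
Proof.
by move=> fg; apply: eq_bigr => s _; rewrite fg // size_tuple.
Qed.

Lemma altLZ n c f (z : 'I_n -> G) :
  altL (fun s => c * f s) z = c * altL f z.
Proof.
by rewrite /altL mulr_sumr; apply: eq_bigr => s _; rewrite mulrCA.
Qed.

(** In the permutation [lift_perm k ord0 s] the first argument occupies position k, and the sign is
    $(-1)^k$ times that of s. *)
Lemma altL_recl n f (z : 'I_n.+1 -> G) :
  altL f z =
  \sum_(k < n.+1) (-1) ^+ k *
    altL (fun s => f (splice k (z ord0) s)) (z \o lift ord0).
Proof.
rewrite /altL (reindex _ (onW_bij _ (lift_perm_bij n))) /=.
rewrite -(pair_bigA _ (fun (k : 'I_n.+1) (s : 'S_n) =>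
  (-1) ^+ lift_perm k ord0 s *
    f [tuple z (lift_perm k ord0 s i) | i < n.+1])) /=.
apply: eq_bigr => k _; rewrite mulr_sumr; apply: eq_bigr => s _.
rewrite (mktuple_splice _ k) lift_perm_id odd_lift_perm addbF signr_addb.
rewrite signr_odd mulrA; under eq_mktuple do rewrite lift_perm_lift.
by [].
Qed.

Lemma signL_homogL q w : homogL q w -> signL w = if odd q then - w else w.
Proof.
move=> hw; apply/funext => s; rewrite /signL -signr_odd.
have [<-|sz] := eqVneq (size s) q.
  by case: odd; rewrite ?mulN1r ?mul1r.
by rewrite hw // mulr0; case: ifP => _; rewrite ?appE hw ?oppr0.
Qed.

Lemma wedL0l t s : wedL (0 : seq G -> K) t s = 0.
Proof. by rewrite -[0 : seq G -> K](subrr 0) wedLDl wedLNl !appE subrr. Qed.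

Lemma wedL0r w s : wedL w (0 : seq G -> K) s = 0.
Proof. by rewrite -[0 : seq G -> K](subrr 0) wedLDr wedLNr !appE subrr. Qed.

Lemma homogL_wedL q r w t : homogL q w -> homogL r t ->
  homogL (q + r)%N (wedL w t).
Proof.
move=> hw ht s; elim: s q r w t hw ht => [|x s IH] q r w t hw ht sz /=.
  case: q hw sz => [|q] hw sz; last by rewrite hw ?mul0r.
  by rewrite ht ?mulr0.
rewrite [X in X + _](_ : _ = 0) ?add0r; last first.
  case: q hw sz => [|q] hw sz; first by rewrite homogL_insert0 // wedL0l.
  by apply: (IH q r) => //; exact: homogL_insert.
case: r ht sz => [|r] ht sz; first by rewrite homogL_insert0 // wedL0r.
apply: (IH q r); [|exact: homogL_insert|by rewrite addnS in sz].
by move=> u uq; rewrite /signL hw ?mulr0.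
Qed.

Lemma take_splice q k (x : G) s : (k < q)%N -> (k <= size s)%N ->
  take q (splice k x s) = splice k x (take q.-1 s).
Proof.
move=> ltkq leks; rewrite /splice take_cat size_takel // ltnNge ltnW //=.
have -> : (q - k)%N = (q.-1 - k).+1 by lia.
have lekq : (k <= q.-1)%N by case: q ltkq.
rewrite /= take_takel //; congr (_ ++ _ :: _).
by rewrite take_drop subnK.
Qed.

(* Permutations are grouped by the position at which they put the first
   argument: it is fed to [w] for q of them and to [t] for the r others. *)
Lemma altL_wedL n q r w t (z : 'I_n -> G) : (q + r = n)%N ->
  homogL q w -> homogL r t -> antisymL w -> antisymL t ->
  altL (fun s => w (take q s) * t (drop q s)) z =
  (q`! * r`!)%:R * wedL w t [tuple z i | i < n].
Proof.
elim: n q r w t z => [|n IH] q r w t z qr hw ht Aw At.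
  have [-> ->] : q = 0 /\ r = 0 by case: q r qr {hw ht} => [[]|].
  rewrite /altL (big_pred1 1%g) => [|s]; last first.
    by apply/esym/eqP/permP => -[].
  by rewrite odd_perm1 !mul1r !(size0nil (size_tuple _)).
set x := z ord0; set z' := z \o lift ord0.
have -> : [tuple z i | i < n.+1] = x :: [tuple z' i | i < n] :> seq G.
  by rewrite (mktuple_splice _ ord0) /splice take0 drop0.
(* A and B collect the permutations that feed x to w and to t. For q = 0, A will occur zero times,
   so the value of [q.-1] is harmless. *)
set A := altL (fun s => insert x w (take q.-1 s) * t (drop q.-1 s)) z'.
set B := altL (fun s => w (take q s) * insert x t (drop q s)) z'.
rewrite altL_recl -/x -/z'.
(* Moving x to the front of its block costs $(-1)^k$ in w and $(-1)^{k-q}$ in t. *)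
have E k : (k <= n)%N ->
    altL (fun s => w (take q (splice k x s)) * t (drop q (splice k x s))) z' =
    (-1) ^+ k * if (k < q)%N then A else (-1) ^+ q * B.
  move=> kn; case: ltnP => [kq|qk].
    rewrite -altLZ; apply: altL_ext => s sz; rewrite take_splice ?sz //.
    have -> : drop q (splice k x s) = drop q.-1 s.
      rewrite /splice drop_cat size_takel ?sz // ltnNge ltnW //=.
      have -> : (q - k)%N = (q.-1 - k).+1 by lia.
      by rewrite /= drop_drop subnK //; lia.
    rewrite [in LHS]/splice antisymL_front // size_takel.
      by rewrite cat_take_drop mulrA.
    by rewrite size_takel ?sz //; lia.
  rewrite mulrA -altLZ; apply: altL_ext => s sz.
  have -> : take q (splice k x s) = take q s.
    by rewrite /splice takel_cat ?size_takel ?sz // take_takel.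
  have -> : drop q (splice k x s) = splice (k - q) x (drop q s).
    rewrite /splice drop_cat size_takel ?sz //; case: ltnP => [qk'|kq].
      by rewrite take_drop drop_drop subnK.
    have -> : k = q by apply/eqP; rewrite eqn_leq qk kq.
    by rewrite subnn /= take0 !drop0.
  rewrite [in LHS]/splice antisymL_front // size_takel; last first.
    by rewrite size_drop sz leq_sub2r.
  rewrite cat_take_drop.
  rewrite -exprD -signr_odd -[(-1) ^+ (k + q)]signr_odd oddB // oddD.
  by rewrite /insert; ring.
(* The sign $(-1)^k$ of the expansion cancels the one in E, leaving q copies of A and r copies of
   $(-1)^q B$. *)
rewrite (eq_bigr (fun k : 'I_n.+1 => if (k < q)%N then A else (-1) ^+ q * B));
  last first.
  move=> k _; rewrite E; last by rewrite -ltnS.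
  rewrite mulrA -expr2 -exprM muln2 -signr_odd odd_double.
  by rewrite mul1r.
rewrite -(big_mkord xpredT (fun k => if (k < q)%N then A else (-1) ^+ q * B)).
rewrite -qr (big_cat_nat _ (leq_addr r q)) //=.
rewrite (eq_big_nat _ _ (F2 := fun _ => A)); last by move=> k /andP[_ ->].
rewrite [X in _ + X](eq_big_nat _ _ (F2 := fun _ => (-1) ^+ q * B)); last first.
  by move=> k /andP[qk _]; rewrite ltnNge qk.
(* The multiplicities q and r complete (q-1)! and (r-1)! to q! and r!, and $(-1)^q w$ is
   [signL w]. *)
rewrite !sumr_const_nat subn0 addKn mulrDr; congr (_ + _).
  case: q @A @B hw qr {E} => [|q] A B hw qr.
    by rewrite homogL_insert0 // wedL0l mulr0 mulr0n.
  rewrite /A (IH q r) //; first last.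
  - exact: antisymL_insert.
  - exact: homogL_insert.
  - by case: qr.
  by rewrite factS -mulrnAl -mulrnA; congr (_%:R * _); lia.
case: r @A @B ht qr {E} => [|r] A B ht qr.
  by rewrite homogL_insert0 // wedL0r mulr0 mulr0n.
rewrite /B (IH q r) //; [|by lia|exact: homogL_insert|exact: antisymL_insert].
rewrite (signL_homogL hw) -signr_odd factS; case: odd.
  rewrite wedLNl appE mulrN mulN1r mulNrn -mulrnAl -mulrnA.
  by congr (- (_%:R * _)); lia.
by rewrite mul1r -mulrnAl -mulrnA; congr (_%:R * _); lia.
Qed.

End ClosedFormulas.

(** * Differentiability in charts *)

Section Differentials.
Variable R : realType.

(** The first-order expansion depends only on the germ, and the differential is unique. *)
Lemma near_eq_diff (V W : normedModType R) (f g : V -> W) x :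
  (\forall y \near x, f y = g y) -> differentiable f x ->
  differentiable g x /\ 'd g x = 'd f x :> (V -> W).
Proof.
move=> fg df.
have e : g \o shift x = cst (g x) + 'd f x +o_ 0 id.
  apply/eqaddoP => eps eps0.
  have /eqaddoP/(_ eps eps0) := diff_locally df => fo.
  have fg0 : \forall h \near (0 : V), f (h + x) = g (h + x).
    have := fg; rewrite (near_shift 0 x) => H; near=> h; rewrite -[x]subr0.
    by near: h.
  near=> h.
  have -> : (g \o shift x - (cst (g x) + 'd f x)) h =
            (f \o shift x - (cst (f x) + 'd f x)) h.
    rewrite !fctE /=; rewrite (nbhs_singleton fg); congr (_ - _).
    by symmetry; near: h.
  by near: h.
have dg : 'd g x = 'd f x :> (V -> W) := diff_unique (diff_continuous df) e.
split=> //; apply/diff_locallyP; rewrite dg; split=> //.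
exact: diff_continuous.
Unshelve. all: by end_near. Qed.

(** Expanding the moving direction X in the standard basis reduces the claim to derivatives of g in
    fixed directions. *)
Lemma differentiable_diff_app (V : normedModType R) n (g : 'rV[R]_n -> R^o)
    (F X : V -> 'rV[R]_n) x :
  (forall v, differentiable (fun y => 'd g y v : R^o) (F x)) ->
  differentiable F x -> differentiable X x ->
  differentiable (fun y => 'd g (F y) (X y) : R^o) x.
Proof.
move=> dg dF dX.
have -> : (fun y => 'd g (F y) (X y) : R^o) =
  \sum_(k < n) (fun y => X y ord0 k * 'd g (F y) (delta_mx ord0 k) : R^o).
  apply/funext => y; rewrite fct_sumE {1}[X y]row_sum_delta linear_sum.
  by apply: eq_bigr => k _; rewrite linearZ.
apply: differentiable_sum => k; apply: differentiableM.
  exact: (@differentiable_comp _ _ _ _ X (fun M : 'rV[R]_n => M ord0 k : R^o)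
    x dX (differentiable_coord _ _ _)).
exact: (@differentiable_comp _ _ _ _ F
  (fun z => 'd g z (delta_mx ord0 k) : R^o) x dF (dg _)).
Qed.

Lemma smooth_on_diff (V W : normedModType R) U (f : V -> W) x :
  smooth_on U f -> U x -> differentiable f x.
Proof. by move=> /(_ 1) [+ _]; exact. Qed.

Lemma smooth_on_diff2 (V W : normedModType R) U (f : V -> W) x v :
  smooth_on U f -> U x -> differentiable (fun y => 'd f y v) x.
Proof. by move=> /(_ 2) [_ /(_ v) [+ _]]; exact. Qed.

Lemma smooth_on_cst (V W : normedModType R) (U : set V) (c : W) :
  smooth_on U (cst c).
Proof.
move=> k; elim: k c => [|k IH] c /=; first by move=> x _; exact: cst_continuous.
split=> [x _|v]; first exact: differentiable_cst.
have -> : (fun x => 'd (cst c) x v) = cst (0 : W).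
  by apply/funext => x; rewrite diff_cst.
exact: IH.
Qed.

End Differentials.

(** * Smoothness under local equality, linear maps and sums *)

Section SmoothOn.
Variable R : realType.

(** As U is open, equality on U is equality near each of its points, so it passes to the
    differentials. *)
Lemma Ck_eq_on (V W : normedModType R) k (U : set V) (f g : V -> W) :
  open U -> (forall x, U x -> f x = g x) -> Ck k U f -> Ck k U g.
Proof.
move=> oU; elim: k f g => [|k IH] f g /= fg.
  move=> cf x Ux; rewrite /prop_for /continuous_at -fg //.
  apply: cvg_trans (cf x Ux); apply: near_eq_cvg.
  by apply: filterS (open_nbhs_nbhs (conj oU Ux)) => y Uy; rewrite fg.
move=> [df Cf]; have e x : U x -> \forall y \near x, f y = g y.
  move=> Ux; apply: filterS (open_nbhs_nbhs (conj oU Ux)) => y Uy.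
  by rewrite fg.
split=> [x Ux|v]; first exact: (near_eq_diff (e x Ux) (df x Ux)).1.
apply: (IH (fun x => 'd f x v) (fun x => 'd g x v) _ (Cf v)) => x Ux.
by have [_ ->] := near_eq_diff (e x Ux) (df x Ux).
Qed.

Lemma Ck_comp_linear (V W W' : normedModType R) k (U : set V) (f : V -> W)
    (L : {linear W -> W'}) :
  continuous L -> open U -> Ck k U f -> Ck k U (L \o f).
Proof.
move=> cL oU; elim: k f => [|k IH] f /=.
  by move=> cf x Ux; apply: continuous_comp; [apply: cf|apply: cL].
move=> [df Cf]; split=> [x Ux|v].
  by apply: differentiable_comp; [apply: df|apply: linear_differentiable].
apply: (@Ck_eq_on _ _ _ _ (L \o (fun x => 'd f x v))) => //; last exact: IH.
move=> x Ux; rewrite diff_comp; [|exact: df|exact: linear_differentiable].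
by rewrite /= diff_lin.
Qed.

Lemma CkD (V W : normedModType R) k (U : set V) (f g : V -> W) :
  open U -> Ck k U f -> Ck k U g -> Ck k U (f + g).
Proof.
move=> oU; elim: k f g => [|k IH] f g /=.
  by move=> cf cg x Ux; apply: continuousD; [apply: cf|apply: cg].
move=> [df Cf] [dg Cg]; split=> [x Ux|v].
  by apply: differentiableD; [apply: df|apply: dg].
apply: (@Ck_eq_on _ _ _ _ ((fun x => 'd f x v) + (fun x => 'd g x v))) => //.
  by move=> x Ux; rewrite diffD; [|apply: df|apply: dg].
exact: IH.
Qed.

(** Erases the base coordinates of a point of a total space: a sum of sections adds fibre
    coordinates but keeps the base point. *)
Definition mask_left n1 n2 (v : 'rV[R]_(n1 + n2)) : 'rV[R]_(n1 + n2) :=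
  row_mx 0 (rsubmx v).

Lemma mask_left_linear n1 n2 : linear (@mask_left n1 n2).
Proof.
move=> a u v; rewrite /mask_left linearP scale_row_mx add_row_mx.
by rewrite scaler0 addr0.
Qed.

HB.instance Definition _ n1 n2 := GRing.isLinear.Build R 'rV[R]_(n1 + n2)
  'rV[R]_(n1 + n2) *:%R (@mask_left n1 n2) (@mask_left_linear n1 n2).

Lemma continuous_mask_left n1 n2 : continuous (@mask_left n1 n2).
Proof.
move=> u A /nbhs_ballP[e /= e0 eA].
apply/nbhs_ballP; exists e => //= v [_ uv]; apply: eA; split => // i j.
rewrite /mask_left; case: (split_ordP j) => k ->.
  by rewrite !row_mxEl; apply: ballxx.
by rewrite !row_mxEr !mxE; apply: uv.
Qed.

End SmoothOn.

(** * Chart expressions and the chain rule *)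

Section Charts.
Variable R : realType.

Definition atlasK (T : Type) (A : atlas R T) :=
  forall (i : aindex A) p, adom i p -> achart_inv i (achart i p) = p.

(** A pointwise consequence of smoothness that composes easily; its first clause keeps nearby values
    inside the target chart. *)
Definition chart_diff (S T : Type) (A : atlas R S) (B : atlas R T) (f : S -> T)
    (p : S) :=
  forall (i : aindex A) (j : aindex B), adom i p -> adom j (f p) ->
    (\forall x \near achart i p, adom j (f (achart_inv i x))) /\
    differentiable (achart j \o f \o achart_inv i) (achart i p).

Lemma smooth_map_chart_diff (S T : Type) (A : atlas R S) (B : atlas R T) f p :
  atlasK A -> smooth_map A B f -> chart_diff A B f p.
Proof.
move=> AK sf i j pi fpj; have [oU sU] := sf i j.
have Up : (achart i @` (adom i `&` f @^-1` adom j)) (achart i p) by exists p.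
split; last exact: smooth_on_diff sU Up.
apply: filterS (open_nbhs_nbhs (conj oU Up)) => _ [q [qi fqj] <-].
by rewrite AK.
Qed.

(** Near the point f stays in the domain of j, so passing through chart j and back does not change
    the composite. *)
Lemma chart_diff_chain (S T : Type) (W : normedModType R) (A : atlas R S)
    (B : atlas R T) (f : S -> T) (g : T -> W) p (i : aindex A) (j : aindex B) :
  atlasK A -> atlasK B -> chart_diff A B f p -> adom i p -> adom j (f p) ->
  differentiable (g \o achart_inv j) (achart j (f p)) ->
  differentiable (g \o f \o achart_inv i) (achart i p) /\
  'd (g \o f \o achart_inv i) (achart i p) =
    'd (g \o achart_inv j) (achart j (f p)) \o
    'd (achart j \o f \o achart_inv i) (achart i p) :> (_ -> _).
Proof.
move=> AK BK df pi fpj dg; have [nf dfij] := df i j pi fpj.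
have e : achart j (f p) = (achart j \o f \o achart_inv i) (achart i p).
  by rewrite /= AK.
rewrite e in dg *.
have n : \forall x \near achart i p,
    ((g \o achart_inv j) \o (achart j \o f \o achart_inv i)) x =
    (g \o f \o achart_inv i) x.
  by apply: filterS nf => x xj; rewrite /= BK.
have [dh ->] := near_eq_diff n (differentiable_comp dfij dg).
by split=> //; rewrite diff_comp.
Qed.

Lemma chart_diff_comp (S T Z : Type) (A : atlas R S) (B : atlas R T)
    (C : atlas R Z) (f : S -> T) (g : T -> Z) p :
  atlasK A -> atlasK B -> (exists j : aindex B, adom j (f p)) ->
  chart_diff A B f p -> chart_diff B C g (f p) -> chart_diff A C (g \o f) p.
Proof.
move=> AK BK [j fpj] df dg i k pi gfpk.
have [nf dfij] := df i j pi fpj; have [ng dgjk] := dg j k fpj gfpk.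
split; last exact: (chart_diff_chain AK BK df pi fpj dgjk).1.
have := differentiable_continuous dfij.
rewrite /prop_for /continuous_at /= AK // => /(_ _ ng).
rewrite nbhs_simpl /= => ngf.
by near=> x; rewrite -(BK j (f _)); [near: x|near: x].
Unshelve. all: by end_near. Qed.

Lemma manifold_atlasK (M : manifold R) : atlasK (matlas M).
Proof. exact: achartK. Qed.

Lemma total_atlasK (M : manifold R) (E : vbundle M) : atlasK (total_atlas E).
Proof.
move=> [i j] [p e] /= [pi pj]; rewrite row_mxKl row_mxKr.
have : achart_inv i (achart i p) = p := achartK pi.
(* The fibre depends on the base point, so the latter is generalized before substitution. The fibre
   element is then unique because [triv] is injective. *)
move: (achart_inv i (achart i p)) => p' p'E; subst p'; congr existT.
case: xgetP => [e' _ /= /(bij_inj (triv_bij pj)) -> // | /(_ e) /= ne].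
by case: ne.
Qed.

Lemma total_atlas_cover (M : manifold R) (E : vbundle M) (e : tot_space E) :
  exists ij : aindex (total_atlas E), adom ij e.
Proof.
have [j pj] := tdom_cover E (projT1 e).
by exists (chart_at (projT1 e), j); split=> //; exact: mem_chart_at.
Qed.

(** With f the identity, [chart_diff_chain] becomes the formula for a change of charts. *)
Lemma chart_diff_id (M : manifold R) (p : M) :
  chart_diff (matlas M) (matlas M) id p.
Proof.
move=> i j pi pj.
have Up : (achart i @` (adom i `&` adom j)) (achart i p) by exists p.
split; last exact: smooth_on_diff (achart_transition i j) Up.
have oU : open (achart i @` (adom i `&` adom j)).
  apply: achart_open; last exact: subIsetl.
  exact: openI (open_adom i) (open_adom j).
apply: filterS (open_nbhs_nbhs (conj oU Up)) => _ [q [qi qj] <-].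
by rewrite achartK.
Qed.

(** * Tangent vectors in arbitrary charts *)

Lemma tangent_spaceP (M : manifold R) (p : M) (v : tangent_space p) :
  (forall i, ~ adom i p -> v i = 0) /\
  (forall i j, adom i p -> adom j p ->
     v j = 'd (achart j \o achart_inv i) (achart i p) (v i)).
Proof. by case: v => v /= /asboolP. Qed.

Definition diff_fun (M : manifold R) (f : M -> R) := forall p (i : mindex M),
  adom i p -> differentiable ((f : M -> R^o) \o achart_inv i) (achart i p).

Lemma CI_diff_fun (M : manifold R) f : CI M f -> diff_fun f.
Proof.
move=> Cf p i pi; apply: smooth_on_diff (Cf i) _.
by exists p.
Qed.

Lemma tangent_actE (M : manifold R) (w : tot_space (tangent M)) f
    (i : mindex M) :
  diff_fun f -> adom i (projT1 w) ->
  tangent_act w f =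
  'd ((f : M -> R^o) \o achart_inv i) (achart i (projT1 w))
    ((projT2 w : tangent_space (projT1 w)) i).
Proof.
move=> df; case: w => p v /= pi; rewrite /tangent_act /=.
have pc := mem_chart_at p; have [_ vE] := tangent_spaceP v.
have [_ e] := chart_diff_chain (@manifold_atlasK M) (@manifold_atlasK M)
  (@chart_diff_id M p) pi pc (df p _ pc).
by rewrite [in LHS](vE i _ pi pc) [in RHS]e.
Qed.

Lemma tangent_mapE (M N : manifold R) (h : M -> N) (w : tot_space (tangent M))
    (i : mindex N) (j : mindex M) :
  smooth_map (matlas M) (matlas N) h ->
  adom j (projT1 w) -> adom i (h (projT1 w)) ->
  (projT2 (tangent_map h w) : tangent_space (h (projT1 w))) i =
  'd (achart i \o h \o achart_inv j) (achart j (projT1 w))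
    ((projT2 w : tangent_space (projT1 w)) j).
Proof.
move=> sh; case: w => p v /=.
have dh : chart_diff (matlas M) (matlas N) h p.
  exact: smooth_map_chart_diff (@manifold_atlasK M) sh.
have pc := mem_chart_at p; set c := chart_at p in pc.
have [v0 vE] := tangent_spaceP v.
(* A witness for the choice in [tangent_map], computed from the single chart c at p. Chart changes
   in N make it a tangent vector; chart changes in M give its coordinates from any other chart. *)
pose w (k : mindex N) : 'rV[R]_(mdim N) := if `[< adom k (h p) >] then
  'd (achart k \o h \o achart_inv c) (achart c p) (v c) else 0.
have wP : w \in tangent_pred (h p).
  apply/asboolP; split=> [k /asboolPn/negbTE|k l pk pl]; rewrite /w.
    by move=> ->.
  rewrite !asboolT //.
  have [_ e] := chart_diff_chain (@manifold_atlasK M) (@manifold_atlasK N)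
    dh pc pk (@chart_diff_id N (h p) k l pk pl).2.
  by have := congr1 (@^~ (v c)) e.
move=> pj hpi; case: xgetP => [w' _ /(_ _ _ pj hpi) //|].
move=> /(_ (TangentVector wP)); case=> k l pk hpl; rewrite /= /w asboolT //.
have [_ e] := chart_diff_chain (@manifold_atlasK M) (@manifold_atlasK M)
  (@chart_diff_id M p) pc pk (dh k l pk hpl).2.
by rewrite (vE c k pc pk); have := congr1 (@^~ (v c)) e.
Qed.

End Charts.

(** * The anchor *)

Section Anchor.
Variables (R : realType) (A : gen_lie_algebroid R).
Notation M := (glaM A).
Notation N := (glaN A).
Notation h := (glah A).
Notation eta := (glaeta A).

(** The anchor before Th is applied: a field of tangent vectors of M along the inverse of h. *)
Definition section_rho (z : rsection (glaF A)) (p : N) :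
    tot_space (tangent M) :=
  vbm_total (glarho A)
    (existT _ (dinv eta (dinv h p)) (z (dinv eta (dinv h p)))).

Lemma section_rhoK z p : h (projT1 (section_rho z p)) = p.
Proof. by rewrite /= !dinvK. Qed.

Lemma section_rho_chart_diff z p : Gamma z ->
  chart_diff (matlas N) (total_atlas (tangent M)) (section_rho z) p.
Proof.
move=> Gz; set s : N -> tot_space (glaF A) := fun q => existT _ q (z q).
have NK := @manifold_atlasK _ N.
have cov (X : manifold R) (q : X) : exists i : mindex X, adom i q.
  by exists (chart_at q); exact: mem_chart_at.
have d1 : chart_diff (matlas N) (matlas N) (dinv eta \o dinv h) p.
  apply: (chart_diff_comp NK (@manifold_atlasK _ M)); first exact: cov.
    by apply: smooth_map_chart_diff => //; exact: dinv_smooth.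
  by apply: smooth_map_chart_diff (@manifold_atlasK _ M) _; exact: dinv_smooth.
have d2 : chart_diff (matlas N) (total_atlas (glaF A))
    (s \o (dinv eta \o dinv h)) p.
  apply: (chart_diff_comp NK NK (cov _ _) d1).
  exact: smooth_map_chart_diff NK Gz.
apply: (chart_diff_comp NK (@total_atlasK _ _ (glaF A)) _ d2).
  exact: total_atlas_cover.
exact: smooth_map_chart_diff (@total_atlasK _ _ (glaF A)) (vbm_smooth _).
Qed.

Lemma anchor_actE (z : rsection (glaF A)) f p (i : mindex N) :
  diff_fun f -> adom i p ->
  anchor_act z f p = 'd ((f : N -> R^o) \o achart_inv i) (achart i p)
    (tvcoord (projT2 (tangent_map h (section_rho z p))) i).
Proof.
move=> df pi.
(* The base point equals p by cancellation of the diffeomorphisms, not by computation. *)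
have wp : projT1 (tangent_map h (section_rho z p)) = p := section_rhoK z p.
have hi : adom i (projT1 (tangent_map h (section_rho z p))) by rewrite wp.
rewrite -[LHS]/(tangent_act (tangent_map h (section_rho z p)) f).
have e : achart i (projT1 (tangent_map h (section_rho z p))) = achart i p.
  by rewrite wp.
by rewrite (tangent_actE df hi) e.
Qed.

Lemma diff_funB f g : diff_fun f -> diff_fun g ->
  @diff_fun R N (f - g).
Proof.
by move=> df dg p i pi; apply: differentiableB; [exact: df|exact: dg].
Qed.

Lemma diff_funM f g : diff_fun f -> diff_fun g ->
  @diff_fun R N (f * g).
Proof.
by move=> df dg p i pi; apply: differentiableM; [exact: df|exact: dg].
Qed.

Lemma anchor_actB (z : rsection (glaF A)) f g : diff_fun f -> diff_fun g ->
  anchor_act z (f - g) = anchor_act z f - anchor_act z g.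
Proof.
move=> df dg; apply/funext => p; rewrite !fctE; have pi := mem_chart_at p.
rewrite !(anchor_actE _ _ pi) //; last exact: diff_funB.
by have := congr1 (@^~ _) (diffB (df _ _ pi) (dg _ _ pi)); apply.
Qed.

Lemma anchor_actM (z : rsection (glaF A)) f g : diff_fun f -> diff_fun g ->
  anchor_act z (f * g) = anchor_act z f * g + f * anchor_act z g.
Proof.
move=> df dg; apply/funext => p; rewrite !fctE; have pi := mem_chart_at p.
rewrite !(anchor_actE _ _ pi) //; last exact: diff_funM.
have e := diffM (df _ _ pi) (dg _ _ pi).
move: (tvcoord _ _) => v; apply: etrans (congr1 (@^~ v) e) _.
have pE : achart_inv (chart_at p) (achart (chart_at p) p) = p := achartK pi.
have fE : f (achart_inv (chart_at p) (achart (chart_at p) p)) = f p.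
  by rewrite pE.
have gE : g (achart_inv (chart_at p) (achart (chart_at p) p)) = g p.
  by rewrite pE.
by rewrite -fE -gE [RHS]addrC [X in _ = _ + X]mulrC.
Qed.

(* Around p, in charts i of N and j of M, the derivative z(f) is
   'd (f \o h \o achart_inv j) evaluated at coordinates of the smooth section
   [section_rho z] of TM, which only involves a fixed pair of charts. *)
Lemma diff_fun_anchor_act (z : rsection (glaF A)) f :
  Gamma z -> CI N f -> diff_fun (anchor_act z f).
Proof.
move=> Gz Cf p i pi; have df := CI_diff_fun Cf.
set m := projT1 (section_rho z p); have mj := mem_chart_at m.
set j := chart_at m in mj.
have sh := dfun_smooth h.
pose H := achart i \o h \o achart_inv j.
pose g := (f : N -> R^o) \o h \o achart_inv j.
pose T x := achart (a := total_atlas (tangent M)) (j, j)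
  (section_rho z (achart_inv i x)).
have [nT dT] := section_rho_chart_diff Gz (i := i) (j := (j, j)) pi
  (conj mj mj).
have hmi : adom i (h m) by rewrite section_rhoK.
have HE q : adom j q -> H (achart j q) = achart i (h q).
  by move=> qj; rewrite /H /= achartK.
have chain q v : adom j q -> adom i (h q) ->
    'd g (achart j q) v = 'd ((f : N -> R^o) \o achart_inv i) (achart i (h q))
      ('d H (achart j q) v).
  move=> qj hqi.
  have dh := smooth_map_chart_diff (p := q) (@manifold_atlasK _ M) sh.
  have [_ e] := chart_diff_chain (@manifold_atlasK _ M) (@manifold_atlasK _ N)
    dh qj hqi (df _ _ hqi).
  by have := congr1 (@^~ v) e.
(* By the chain rule this is the derivative of f in chart i, taken at the moving point H(y) in the
   moving direction ['d H y v]. *)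
have dg v : differentiable (fun y => 'd g y v : R^o) (achart j m).
  have [oU sU] := sh j i; set U := achart j @` _ in oU sU.
  have Um : U (achart j m) by exists m.
  have near_g : \forall y \near achart j m,
      'd ((f : N -> R^o) \o achart_inv i) (H y) ('d H y v) = 'd g y v.
    apply: filterS (open_nbhs_nbhs (conj oU Um)) => _ [q [qj hqi] <-].
    by rewrite (chain _ _ qj hqi) (HE _ qj).
  apply: (near_eq_diff (W := R^o) near_g _).1; apply: differentiable_diff_app.
  - move=> u; rewrite HE //; apply: smooth_on_diff2 (Cf i) _.
    by exists (h m).
  - exact: smooth_on_diff sU Um.
  - exact: smooth_on_diff2 sU Um.
(* T holds the base and fibre coordinates of the section, so z(f) is again a derivative at a moving
   point in a moving direction. *)
have near_f : \forall x \near achart i p,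
    'd g (lsubmx (T x)) (rsubmx (T x)) = anchor_act z f (achart_inv i x).
  have [ni _] := @chart_diff_id _ N p i i pi pi.
  apply: filterS (filterI ni nT) => x; set q := achart_inv i x.
  move=> [qi [qj _]].
  have hqi : adom i (h (projT1 (section_rho z q))) by rewrite section_rhoK.
  rewrite /T /= row_mxKl row_mxKr (chain _ _ qj hqi).
  rewrite (anchor_actE _ df qi) (tangent_mapE sh qj hqi).
  by rewrite section_rhoK.
apply: (near_eq_diff (W := R^o) near_f _).1; apply: differentiable_diff_app.
- by move=> v; rewrite /T /= row_mxKl achartK.
- by apply: differentiable_comp => //; exact: differentiable_lsubmx.
- by apply: differentiable_comp => //; exact: differentiable_rsubmx.
Qed.

End Anchor.

(** * From forms to functions on lists *)

Section Sections.
Variables (R : realType).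

Lemma CI_cst (M : manifold R) (c : R) : CI M (cst c).
Proof.
move=> i; have -> : (cst c : M -> R^o) \o achart_inv i = cst c by [].
exact: smooth_on_cst.
Qed.

(** Polarizing an alternating form requires evaluating it at sums of smooth sections. *)
Lemma GammaD (M : manifold R) (E : prebundle M) (u v : rsection E) :
  Gamma u -> Gamma v -> Gamma (fun p => u p + v p).
Proof.
move=> Gu Gv i j; have [oU sU] := Gu i j; have [_ sV] := Gv i j.
split=> [|k]; first exact: oU.
pose c w := achart (a := total_atlas E) j \o
  (fun p => existT _ p (w p) : tot_space E) \o achart_inv i.
have -> : achart (a := total_atlas E) j \o
    (fun p => existT _ p (u p + v p) : tot_space E) \o achart_inv i =
    c u + (@mask_left R _ _ \o c v).
  apply/funext => x; rewrite /c /= !fctE /= /mask_left row_mxKr linearD.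
  by rewrite add_row_mx addr0.
apply: CkD; [exact: oU|exact: sU|apply: Ck_comp_linear].
- exact: continuous_mask_left.
- exact: oU.
- exact: sV.
Qed.

End Sections.

Section ListOfForm.
Variables (R : realType) (A : gen_lie_algebroid R).
Notation N := (glaN A).
Notation F := (glaF A).

(** Bundling smoothness makes the bracket, constrained only on smooth sections, a total operation
    with all its laws. *)
Let G : Type := {z : rsection F | Gamma z}.
Let K : Type := N -> R.

Definition brG (x y : G) : G :=
  exist _ (gbr (sval x) (sval y)) (gbr_Gamma (svalP x) (svalP y)).

Definition rhoG (x : G) (f : K) : K := anchor_act (sval x) f.

Lemma rhoB x f g : diff_fun f -> diff_fun g ->
  rhoG x (f - g) = rhoG x f - rhoG x g.
Proof. exact: anchor_actB. Qed.

Lemma rhoM x f g : diff_fun f -> diff_fun g ->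
  rhoG x (f * g) = rhoG x f * g + f * rhoG x g.
Proof. exact: anchor_actM. Qed.

Lemma rhoD2 x f : CI N f -> diff_fun (rhoG x f).
Proof. by move=> Cf; apply: diff_fun_anchor_act => //; exact: (svalP x). Qed.

Lemma rho_br x y f : CI N f ->
  rhoG (brG x y) f = rhoG x (rhoG y f) - rhoG y (rhoG x f).
Proof. by move=> Cf; exact: gbr_anchor (svalP x) (svalP y) _ Cf. Qed.

Lemma diff_fun1 : diff_fun (1 : K).
Proof. by move=> p i pi; exact: (CI_diff_fun (@CI_cst R N 1)). Qed.

Definition nth_section (s : seq G) (k : nat) : rsection F :=
  nth (fun _ => 0) (map sval s) k.

Lemma nth_sectionE x0 s k : (k < size s)%N ->
  nth_section s k = sval (nth x0 s k).
Proof. exact: nth_map. Qed.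

Lemma Gamma_nth_section s k : (k < size s)%N -> Gamma (nth_section s k).
Proof.
case: s => // x s ks; rewrite (nth_sectionE x ks); exact: svalP.
Qed.

Definition toL q (w : preform A q) (s : seq G) : K :=
  if size s == q then w (fun k => nth_section s k) else 0.

Lemma toLE q (w : preform A q) s : size s = q ->
  toL w s = w (fun k => nth_section s k).
Proof. by rewrite /toL => ->; rewrite eqxx. Qed.

Lemma homogL_toL q (w : preform A q) : homogL q (toL w).
Proof. by move=> s /negbTE sz; rewrite /toL sz. Qed.

(** [form_eq] tests smooth tuples, and each of them is read off a list. *)
Lemma toL_seq q (z : 'I_q -> rsection F) : Gammas z ->
  {s : seq G | size s = q & forall k : 'I_q, nth_section s k = z k}.
Proof.
move=> Gz; exists [tuple exist _ (z i) (Gz i) : G | i < q] => [|k].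
  exact: size_tuple.
have kq : (k < size [tuple exist _ (z i) (Gz i) : G | i < q])%N.
  by rewrite size_tuple.
by rewrite (nth_sectionE (exist _ _ (Gz k)) kq) nth_mktuple.
Qed.

(** Puts a list entry into the updated-tuple form in which [Lambda] states linearity; y is a
    placeholder. *)
Lemma nth_section_splice q s1 x y s2 (i : 'I_q) : size s1 = i ->
  (fun k : 'I_q => nth_section (s1 ++ x :: s2) k) =
  [eta (fun k : 'I_q => nth_section (s1 ++ y :: s2) k) with i |-> sval x].
Proof.
move=> s1i; apply/funext => k /=; rewrite /nth_section !map_cat /= !nth_cat.
rewrite !size_map s1i; case: eqVneq => [->|ki]; first by rewrite ltnn subnn.
case: ltngtP => // [ik|/val_inj ki']; last by rewrite ki' eqxx in ki.
by rewrite -(subnSK ik).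
Qed.

Lemma Gammas_nth_section q s : size s = q ->
  Gammas (fun k : 'I_q => nth_section s k).
Proof. by move=> sq i; apply: Gamma_nth_section; rewrite sq. Qed.

Section OfLambda.
Variables (q : nat) (w : preform A q).
Hypothesis Lw : Lambda w.

Lemma smoothL_toL : smoothL (CI N) (toL w).
Proof.
case: Lw => Cw _ _ s; rewrite /toL; case: eqP => [sz|_].
  exact/Cw/Gammas_nth_section.
exact: (@CI_cst R N 0).
Qed.

(** As [G] has no module structure, t is any element whose underlying section is the combination of
    u and v. *)
Lemma linear_toL c t u v s1 s2 :
  (forall p, sval t p = c *: sval u p + sval v p) ->
  toL w (s1 ++ t :: s2) =
  (cst c : K) * toL w (s1 ++ u :: s2) + toL w (s1 ++ v :: s2).
Proof.
move=> tE; have [sz|sz] := eqVneq (size (s1 ++ u :: s2)) q; last first.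
  have hu x : toL w (s1 ++ x :: s2) = 0.
    by apply: homogL_toL; move: sz; rewrite !size_cat.
  by rewrite !hu mulr0 addr0.
have ltq : (size s1 < q)%N by rewrite -sz size_cat /= addnS ltnS leq_addr.
have szx x : size (s1 ++ x :: s2) = q by rewrite -sz !size_cat.
rewrite !toLE ?szx // (@nth_section_splice q s1 t u s2 (Ordinal ltq)) //.
rewrite [in RHS](@nth_section_splice q s1 v u s2 (Ordinal ltq)) //.
have -> : sval t = (fun p => cst c p *: sval u p + sval v p).
  by apply: functional_extensionality_dep => p; rewrite tE.
case: Lw => _ lw _; rewrite lw; last exact: CI_cst.
- congr (_ * w _ + _).
  by rewrite -(@nth_section_splice q s1 u u s2 (Ordinal ltq)).
- exact/Gammas_nth_section/szx.
- exact: svalP.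
- exact: svalP.
Qed.

Lemma alternating_toL x s1 s2 : toL w (s1 ++ x :: x :: s2) = 0.
Proof.
have [sz|sz] := eqVneq (size (s1 ++ x :: x :: s2)) q; last exact: homogL_toL.
have lt1 : ((size s1).+1 < q)%N.
  by rewrite -sz size_cat /= !addnS !ltnS leq_addr.
have lt0 : (size s1 < q)%N by exact: ltnW.
rewrite toLE //; case: Lw => _ _ aw.
apply: (aw _ (Ordinal lt0) (Ordinal lt1)).
- exact: Gammas_nth_section.
- by rewrite -val_eqE /= neq_ltn ltnSn.
rewrite /nth_section !map_cat !nth_cat /= !size_map ltnn ltnNge leqnSn /=.
by rewrite subnn subSnn.
Qed.

(** Polarization: expand the vanishing value at the repeated entry x + y. *)
Lemma antisymL_toL : antisymL (toL w).
Proof.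
move=> s1 x y s2.
pose t : G := exist _ _ (GammaD (svalP x) (svalP y)).
have tE p : sval t p = 1 *: sval x p + sval y p by rewrite scale1r.
have e := alternating_toL t s1 s2; move: e.
(* The first slot is absorbed into the prefix so that the second one can be expanded. *)
rewrite (linear_toL _ _ tE) -![s1 ++ _ :: t :: _]cat_rcons !(linear_toL _ _ tE).
rewrite !cat_rcons !alternating_toL.
have -> : cst 1 = 1 :> K by [].
by rewrite !mul1r add0r addr0 => /eqP; rewrite addr_eq0 => /eqP.
Qed.

(* Additivity is only available for smooth sections, and -u is reached as
   (-2) u + u without knowing that the zero section is smooth. *)
Lemma skew_brL_toL : skew_brL brG (toL w).
Proof.
move=> s1 x y s2.
have e p : sval (brG x y) p = (- 2) *: sval (brG y x) p + sval (brG y x) p.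
  rewrite /= (gbr_antisym (svalP x) (svalP y)) scaleNr scaler_nat mulr2n.
  by rewrite opprD addrNK.
rewrite (linear_toL _ _ e); have -> : cst (- 2) = - 2 :> K.
  by apply/funext => p; rewrite !fctE natmulfctE.
ring.
Qed.

Lemma jacobiL_toL : jacobiL brG (toL w).
Proof.
move=> s1 s2 x y z.
have [Gx Gy Gz] := And3 (svalP x) (svalP y) (svalP z).
have Gxz := gbr_Gamma Gx Gz; have Gxy := gbr_Gamma Gx Gy.
have e p : sval (brG (brG x y) z) p =
    (- 1) *: sval (brG y (brG x z)) p + sval (brG x (brG y z)) p.
  rewrite /= scaleN1r (gbr_antisym Gxy Gz); apply/eqP.
  have := gbr_jacobi Gx Gy Gz p.
  (* The opposite of $[x,z]$ is written as $(-2)[x,z] + [x,z]$ to match the form of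
     [gbr_linearr]. *)
  have -> : gbr (sval z) (sval x) = (fun p =>
      (- 2) *: gbr (sval x) (sval z) p + gbr (sval x) (sval z) p).
    apply: functional_extensionality_dep => {}p.
    rewrite (gbr_antisym Gz Gx) scaleNr scaler_nat mulr2n.
    by rewrite opprD addrNK.
  rewrite (gbr_linearr _ Gxz Gxz Gy) scaleNr scaler_nat mulr2n opprD addrNK.
  by move=> /eqP; rewrite addr_eq0 eq_sym addrC.
rewrite (linear_toL _ _ e); have -> : cst (- 1) = - 1 :> K by [].
ring.
Qed.

End OfLambda.

Lemma Lie_toL (z : G) q (w : preform A q) :
  toL (Lie (sval z) w) = lieL brG rhoG z (toL w).
Proof.
apply/funext => s; have [sz|sz] := eqVneq (size s) q; last first.
  rewrite homogL_toL // (homogL_lieL _ diff_fun1 _ rhoB _ (homogL_toL w)) //.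
  exact: diff_funB.
rewrite (lieL_sum _ _ z) !toLE //; apply/funext => p.
rewrite !fctE fct_sumE sz; congr (_ - _); apply: eq_bigr => i _.
have iq : (i < size s)%N by rewrite sz.
rewrite toLE ?size_set_nth ?sz; last exact/maxn_idPr.
congr (w _ p); rewrite set_nthE iq.
rewrite (@nth_section_splice q _ _ (nth z s i) _ i) ?size_takel ?(ltnW iq) //.
rewrite -(drop_nth z iq) cat_take_drop.
by rewrite /= (nth_sectionE z iq).
Qed.

Lemma nth_section_cut i (s : seq G) k : (i < size s)%N ->
  nth_section (cut i s) k = nth_section s (bump i k).
Proof.
move=> lti; rewrite /nth_section /cut map_cat map_take map_drop.
by rewrite -[take _ _ ++ _]/(cut i _) nth_cut ?size_map.
Qed.

Lemma sign_fctE (T : Type) n (f : T -> R) p :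
  ((-1) ^+ n * f) p = (-1) ^+ n * f p.
Proof. by rewrite !fctE. Qed.

Lemma dF_toL q (w : preform A q) : antisymL (toL w) ->
  toL (dF w) = difL brG rhoG (toL w).
Proof.
move=> Aw; apply/funext => s.
have [sz|sz] := eqVneq (size s) q.+1; last first.
  rewrite homogL_toL // (homogL_difL _ diff_fun1 _ rhoB (homogL_toL w)) //.
  exact: diff_funB.
have x0 : G by case: s sz.
rewrite (difL_sum _ _ x0) // toLE //; apply/funext => p.
rewrite !fctE !fct_sumE sz; congr (_ + _); apply: eq_bigr => i _.
  have iq : (i < size s)%N by rewrite sz.
  have -> : toL w (cut i s) = w (fun k => nth_section s (lift i k)).
    rewrite toLE; last by rewrite size_cut // sz.
    by congr w; apply/funext => k; rewrite nth_section_cut.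
  rewrite sign_fctE; congr (_ * anchor_act _ _ p).
  exact: nth_sectionE.
rewrite fct_sumE; apply: eq_bigr => j ij; rewrite sign_fctE; congr (_ * _).
have iq : (i < size s)%N by rewrite sz.
have jq : (j < size s)%N by rewrite sz.
have jc : (i < size (cut j s))%N by rewrite size_cut // sz; lia.
rewrite toLE; last by rewrite /= !size_cut // sz; have := ltn_ord j; lia.
congr (w _ p); apply/funext => k; case: eqP => [->|/eqP k0].
  by rewrite /nth_section /= -!/(nth_section _ _) !(nth_sectionE x0).
(* The bracket takes slot 0, so slot k + 1 reads entry k of the doubly cut list; the double [bump]
   stays below [q.+1], where [inord] keeps its value. *)
case: k k0 => [[|k] kq] //= _.
rewrite -[RHS]/(nth_section (cut i (cut j s)) k) !nth_section_cut //.
by rewrite inordK // /bump; lia.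
Qed.

(** The sum in [wedge] is the [altL] of [altL_wedL], so it equals q! r! times [wedL]; this factor is
    invertible in R. *)
Lemma wedge_toL q r (w : preform A q) (t : preform A r) :
  antisymL (toL w) -> antisymL (toL t) ->
  toL (wedge w t) = wedL (toL w) (toL t).
Proof.
move=> Aw At; apply/funext => s.
have [/eqP sz|sz] := eqVneq (size s) (q + r)%N; last first.
  by rewrite homogL_toL // (homogL_wedL (@homogL_toL _ w) (@homogL_toL _ t)).
have [hw ht] := (@homogL_toL _ w, @homogL_toL _ t).
have e := altL_wedL (tnth (Tuple sz)) (erefl _) hw ht Aw At.
have st : [tuple tnth (Tuple sz) i | i < q + r] = s :> seq G.
  by rewrite -[RHS]/(tval (Tuple sz)); congr tval; apply: eq_from_tnth => i;
    rewrite tnth_mktuple.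
rewrite st in e; rewrite toLE; last exact/eqP.
apply/funext => p; rewrite /wedge.
have fact_neq0 : (q`! * r`!)%:R != 0 :> R.
  by rewrite pnatr_eq0 -lt0n muln_gt0 !fact_gt0.
apply: (mulfI fact_neq0); rewrite mulVKf //.
have -> : (q`! * r`!)%:R * wedL (toL w) (toL t) s p =
    ((q`! * r`!)%:R * wedL (toL w) (toL t) s) p.
  by rewrite !fctE natmulfctE.
rewrite -e /altL fct_sumE; apply: eq_bigr => u _.
rewrite -mulrA sign_fctE; congr (_ * _).
have szu : size [tuple tnth (Tuple sz) (u i) | i < q + r] = (q + r)%N.
  exact: size_tuple.
have nthu (i : 'I_(q + r)) :
    nth_section [tuple tnth (Tuple sz) (u i) | i < q + r] i =
    nth_section s (u i).
  have x0 := tnth (Tuple sz) i.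
  rewrite !(nth_sectionE x0) ?szu ?(eqP sz) // nth_mktuple.
  by rewrite (tnth_nth x0).
rewrite !toLE; first last.
- by rewrite size_takel // szu leq_addr.
- by rewrite size_drop szu addKn.
rewrite [RHS]/(_ * _); congr (w _ p * t _ p); apply/funext => k.
  by rewrite -nthu /nth_section map_take nth_take.
by rewrite -nthu /nth_section map_drop nth_drop.
Qed.

End ListOfForm.

(** * The three identities, transferred from lists to forms *)

Theorem theorem2p8 (R : realType) (A : gen_lie_algebroid R) :
  (forall (q r : nat) (w : preform A q) (t : preform A r),
     Lambda w -> Lambda t ->
     form_eq (dF (wedge w t))
       (fun z p => wedge (dF w) t z p +
          (-1) ^+ q * wedge w (dF t) (z \o cast_ord (addnS q r)) p)) /\
  (forall z : rsection (glaF A), Gamma z ->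
     forall (q : nat) (w : preform A q), Lambda w ->
       form_eq (Lie z (dF w)) (dF (Lie z w))) /\
  (forall (q : nat) (w : preform A q), Lambda w ->
     form_eq (dF (dF w)) (fun _ _ => 0)).
Proof.
have dfB := @diff_funB R A; have dfM := @diff_funM R A.
have df1 := @diff_fun1 R A; have CId := @CI_diff_fun R (glaN A).
have toL_eq q (w : preform A q) z s :
    size s = q -> (forall k : 'I_q, nth_section s k = z k) -> w z = toL w s.
  by move=> sq sE; rewrite toLE //; congr w; apply/funext => k; rewrite sE.
have smooth q (w : preform A q) : Lambda w -> smoothL (CI (glaN A)) (toL w).
  exact: smoothL_toL.
have diff q (w : preform A q) :
    Lambda w -> diffL (@diff_fun R (glaN A)) (toL w).
  by move=> /smooth/(smoothL_diffL CId).
have dFL q (w : preform A q) : Lambda w ->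
    toL (dF w) = difL (@brG R A) (@rhoG R A) (toL w).
  by move=> Lw; apply: dF_toL; exact: antisymL_toL.
(* This antisymmetry is what [dF_toL] and [wedge_toL] require in order to be applied to [dF w]. *)
have dFA q (w : preform A q) : Lambda w -> antisymL (toL (dF w)).
  move=> Lw; rewrite dFL //.
  apply: (antisymL_difL df1 dfB CId (@rhoB R A) (smooth _ _ Lw)).
    exact: antisymL_toL.
  exact: skew_brL_toL.
split; [|split].
- move=> q r w t Lw Lt z Gz; apply/funext => p.
  have [s sz sE] := toL_seq Gz.
  have Aw := antisymL_toL Lw; have At := antisymL_toL Lt.
  rewrite (toL_eq _ (dF (wedge w t)) z s) // dF_toL wedge_toL //; last first.
    exact: antisymL_wedL.
  rewrite (difL_wedL _ df1 dfB dfM (@rhoB R A) (@rhoM R A)); [|exact: diff..].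
  rewrite -!dFL // appE [LHS]/(_ + _); congr (_ + _).
    rewrite -wedge_toL //; last exact: dFA.
    by rewrite (toL_eq _ (wedge (dF w) t) z s).
  (* The cast between the index types [(q + r).+1] and [q + r.+1] keeps the underlying numbers, so
     the same list s represents both tuples. *)
  rewrite (toL_eq _ (wedge w (dF t)) _ s); first last.
  - by move=> k; rewrite /= -sE.
  - by rewrite sz addnS.
  rewrite wedge_toL //; last exact: dFA.
  rewrite (signL_homogL (@homogL_toL _ _ _ w)) -signr_odd; case: odd.
    by rewrite wedLNl appE mulN1r.
  by rewrite mul1r.
- move=> z Gz q w Lw zs Gzs.
  have [s sz sE] := toL_seq Gzs.
  rewrite (toL_eq _ (Lie z (dF w)) zs s) // (toL_eq _ (dF (Lie z w)) zs s) //.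
  rewrite (Lie_toL (exist _ z Gz)) dFL //.
  rewrite dF_toL (Lie_toL (exist _ z Gz)).
    rewrite (lieL_difL df1 dfB CId (@rhoB R A) (@rhoD2 R A) (@rho_br R A)) //.
      exact: smooth.
    exact: jacobiL_toL.
  apply: (antisymL_lieL _ df1 dfB (@rhoB R A)); first exact: diff.
  exact: antisymL_toL.
- move=> q w Lw z Gz.
  have [s sz sE] := toL_seq Gz.
  rewrite (toL_eq _ (dF (dF w)) z s) // dF_toL; last exact: dFA.
  rewrite dFL //.
  apply: (difL_difL df1 dfB CId (@rhoB R A) (@rhoD2 R A) (@rho_br R A)).
    exact: smooth.
  exact: jacobiL_toL.
Qed.
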